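(* Let $p$ be a prime and $k$ a positive integer. Then there exists an AP-destroying permutation of the group $(\mathbb{Z}/p\mathbb{Z})^k$ if and only if $p$ is odd and $(p,k)\notin\{(3,1),(5,1),(7,1)\}$.
   Context: Let $G$ be an abelian group. A permutation $\pi:G\to G$ is called AP-destroying if there is no ordered triple $(a,b,c)\in G^3$ with $b-a=c-b\neq 0$ and $\pi(b)-\pi(a)=\pi(c)-\pi(b)$; that is, whenever $(a,b,c)$ is a nonconstant 3-term arithmetic progression in $G$, the triple $(\pi(a),\pi(b),\pi(c))$ is not an arithmetic progression. *)

(* Defs.v *)
From mathcomp Require Import all_boot all_algebra.

Set Implicit Arguments.
Unset Strict Implicit.
Unset Printing Implicit Defensive.

Import GRing.Theory.
Local Open Scope ring_scope.

Definition ap_destroying (G : zmodType) (pi : G -> G) : Prop :=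
  bijective pi /\
  ~ exists a b c : G,
      [/\ b - a = c - b, c - b <> 0 & pi b - pi a = pi c - pi b].

(* Main.v *)
Require Import Defs.
From Stdlib Require Import ZArith.
From mathcomp Require Import all_boot all_order all_fingroup all_algebra all_field.
From mathcomp Require Import ring lra zify ssrZ.

Set Implicit Arguments.
Unset Strict Implicit.
Unset Printing Implicit Defensive.

Import GRing.Theory Num.Theory Order.TTheory.
Local Open Scope ring_scope.

(* On [F_p] the map [x -> 1/x] (with [0 -> 0]) preserves very few progressions:
   none that avoids [0], since [1/(b-d) + 1/(b+d) = 2/b] forces [d = 0].  Composing
   it with the cycle [0 -> 2 -> t -> 3 -> 0] destroys all of them as soon as four
   discriminants, which are quadratic polynomials in [t], are nonsquares and [t]
   avoids finitely many values.  For [p >= 3100] such a [t] exists because the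
   sums of the quadratic character over products of these polynomials are small:
   a Möbius substitution reduces them to polynomials of degree 1 and 3, and cubic
   sums are bounded by Stepanov's method.  For smaller [p] a suitable [t] is
   exhibited, except for four primes, which are treated by explicit tables.
   A product of AP-destroying permutations is AP-destroying, so that only finitely
   many checks remain, with [p <= 7] and [k <= 3]; for [p = 2] every permutation
   preserves the progressions [(a, b, a)]. *)

(** * Stepanov's method for cubic polynomials *)

(** A progression whose only moved term is [0] or [3] gives a condition that is impossible or has a
    single solution, itself a moved point. The shorter cycle [0 -> 2 -> 3 -> 0] would nevertheless
    fail for [p >= 11]: it sends [2] to [1/3] and preserves [(2, 4, 6)], as [1/3 + 1/6 = 2/4].
    Inserting [t] turns the conditions at [2] and at [t] into genuine quadratics, two for each
    point, and leaves a parameter that can make their four discriminants nonsquares. The values of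
    [t] are counted with a weight that is a product of four factors [1 + chi] or [1 - chi]. It
    expands into a main term [p] and fifteen character sums, nine of which need the cubic bound.
    With [J = 16] the total error is at most [18 p / 31 + 1280], which is below [p] once [p > 3052];
    hence the threshold 3100. With [J = 17] the degree condition [2 D + 3 < p] alone would demand
    [p > 3171]. *)

Lemma dependent_family (F : fieldType) (U T : finType) (L : U -> T -> F) :
  (#|T| < #|U|)%N ->
  exists v : U -> F, (exists u, v u != 0) /\
    (forall t, \sum_u v u * L u t = 0).
Proof.
move=> ltTU.
pose A := \matrix_(i < #|U|, j < #|T|) L (enum_val i) (enum_val j).
have /rowV0Pn[w /sub_kermxP wA w0] : kermx A != 0.
  rewrite -mxrank_eq0 mxrank_ker -lt0n subn_gt0.
  exact: leq_ltn_trans (rank_leq_col A) ltTU.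
exists (fun u => w 0 (enum_rank u)); split.
  have /matrix0Pn[i [j wj]] := w0.
  by exists (enum_val j); rewrite enum_valK -(ord1 i).
move=> t; have := congr1 (fun B : 'rV_ _ => B 0 (enum_rank t)) wA.
rewrite !mxE (reindex enum_rank) /=; last exact/onW_bij/enum_rank_bij.
by under eq_bigr do rewrite mxE !enum_rankK.
Qed.

(** Among the terms with nonzero coefficient, the one of largest size keeps its leading coefficient,
    because all other sizes differ from it. *)
Lemma lincomb_neq0 (F : fieldType) (U : finType) (e : U -> {poly F}) (v : U -> F) (u0 : U) :
  injective (fun u => size (e u)) -> (forall u, e u != 0) -> v u0 != 0 ->
  \sum_u v u *: e u != 0.
Proof.
move=> einj e0 vu0.
case: (@arg_maxnP _ u0 (fun u => v u != 0) (fun u => size (e u)) vu0) => u vu umax.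
apply/eqP => /(congr1 (fun q : {poly F} => q`_(size (e u)).-1)).
rewrite coef_sum coef0 (bigD1 u) //= big1 ?addr0 => [|w wu].
  by apply/eqP; rewrite coefZ -lead_coefE mulf_neq0 // lead_coef_eq0.
have [->|vw] := eqVneq (v w) 0; first by rewrite scale0r coef0.
rewrite coefZ nth_default ?mulr0 //.
have /= := umax w vw; rewrite /geq /= leq_eqVlt => /orP[/eqP eq|].
  by rewrite (einj _ _ eq) eqxx in wu.
by have := e0 u; rewrite -size_poly_gt0; case: (size (e u)).
Qed.

(* The coefficient of [f ^+ h] in [f ^+ k * (B * f ^+ h)^`(k)]. *)
Fixpoint twisted_deriv (F : fieldType) (f : {poly F}) (h k : nat) (B : {poly F}) :=
  if k is k'.+1 then
    let C := twisted_deriv f h k' B in f * C^`() + (h%:R - k'%:R) *: (f^`() * C)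
  else B.

Lemma mul_deriv_exp (F : fieldType) (f : {poly F}) (n : nat) :
  f * (f ^+ n)^`() = n%:R *: (f^`() * f ^+ n).
Proof.
case: n => [|n]; first by rewrite expr0 derivC mulr0 scale0r.
by rewrite deriv_exp /= mulrnAr scaler_nat mulrCA exprS.
Qed.

Lemma twisted_derivE (F : fieldType) (f B : {poly F}) (h k : nat) :
  f ^+ k * (B * f ^+ h)^`(k) = twisted_deriv f h k B * f ^+ h.
Proof.
elim: k => [|k IHk]; first by rewrite expr0 mul1r derivn0.
rewrite derivnS /=; set D := (B * f ^+ h)^`(k) in IHk *.
set C := twisted_deriv f h k B in IHk *.
(* The induction hypothesis is differentiated and multiplied by [f]; the term in which the prefactor
   [f ^+ k] is differentiated moves to the other side and produces the [- k] in the coefficient of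
   [twisted_deriv]. *)
have dIHk : (f ^+ k)^`() * D + f ^+ k * D^`() = C^`() * f ^+ h + C * (f ^+ h)^`().
  by rewrite -!derivM IHk.
have -> : f ^+ k.+1 * D^`() =
    f * C^`() * f ^+ h + C * (f * (f ^+ h)^`()) - (f * (f ^+ k)^`()) * D.
  by rewrite exprS -mulrA -[f ^+ k * D^`()](addKr ((f ^+ k)^`() * D)) dIHk; ring.
rewrite !mul_deriv_exp -!mul_polyC polyCB.
have -> : k%:R%:P * (f^`() * f ^+ k) * D = k%:R%:P * f^`() * (f ^+ k * D) by ring.
by rewrite IHk; ring.
Qed.

Lemma size_deriv_leq (F : fieldType) (f : {poly F}) (n : nat) :
  (size f <= n.+1)%N -> (size f^`() <= n)%N.
Proof.
have [->|f0] := eqVneq f 0; first by rewrite deriv0 size_poly0.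
by move=> sf; rewrite -ltnS (leq_trans (lt_size_deriv f0)).
Qed.

(** Each step raises the degree by at most 2: one factor of degree at most 3, and one
    differentiation. *)
Lemma size_twisted_deriv (F : fieldType) (f B : {poly F}) (h k n : nat) :
  (size f <= 4)%N -> (size B <= n.+1)%N ->
  (size (twisted_deriv f h k B) <= n.+1 + 2 * k)%N.
Proof.
move=> sf sB; elim: k => [|k IHk] /=; first by rewrite muln0 addn0.
set C := twisted_deriv f h k B in IHk *.
have dC : (size C^`() <= n + 2 * k)%N.
  by apply: size_deriv_leq; lia.
have df : (size f^`() <= 3)%N by exact: size_deriv_leq.
apply: leq_trans (size_polyD _ _) _; rewrite geq_max; apply/andP; split.
  by apply: leq_trans (size_polyMleq _ _) _; lia.
apply: leq_trans (size_scale_leq _ _) _.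
by apply: leq_trans (size_polyMleq _ _) _; lia.
Qed.

(** In positive characteristic, vanishing derivatives control the multiplicity only while the factor
    [m] that comes from differentiating [('X - x%:P) ^+ m] is invertible. If the multiplicity were
    too small, this factor times the cofactor [Q] would have to vanish at [x]. *)
Lemma dvdp_XsubC_exp (F : fieldType) (P : {poly F}) (x : F) (M : nat) :
  (forall m, (0 < m < M)%N -> m%:R != 0 :> F) ->
  (forall k, (k < M)%N -> P^`(k).[x] = 0) -> ('X - x%:P) ^+ M %| P.
Proof.
elim: M P => [|M IHM] P charM zeroP; first by rewrite expr0 dvd1p.
have [->|P0] := eqVneq P 0; first by rewrite dvdp0.
have dP : ('X - x%:P) ^+ M %| P^`().
  apply: IHM => [m /andP[m0 mM]|k kM]; first by apply: charM; rewrite m0 ltnS ltnW.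
  by rewrite -derivSn; apply: zeroP.
have [m [Q]] := multiplicity_XsubC P x; rewrite P0 /= => Qx defP.
have [Mm|mM] := ltnP M m; first by rewrite defP dvdp_mull // dvdp_exp2l.
have Px : root P x by apply/rootP; apply: (zeroP 0%N).
case: m mM defP => [|m] mM defP; first by rewrite defP expr0 mulr1 (negPf Qx) in Px.
case/negP: Qx; move: dP.
have -> : P^`() = ('X - x%:P) ^+ m * (('X - x%:P) * Q^`() + Q *+ m.+1).
  rewrite defP derivM deriv_exp /= derivXsubC mul1r exprS -[Q *+ m.+1]mulr_natr.
  rewrite -[_ ^+ m *+ _]mulr_natr.
  by move: (m.+1%:R) (('X - x%:P) ^+ m) ('X - x%:P) => n Z Y; ring.
rewrite -{1}(subnKC (ltnW mM)) exprD dvdp_mul2l ?expf_neq0 ?polyXsubC_eq0 // => dQ.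
have : 'X - x%:P %| ('X - x%:P) * Q^`() + Q *+ m.+1.
  by apply: dvdp_trans dQ; rewrite dvdp_exp // subn_gt0.
rewrite dvdp_addr ?dvdp_mulr // dvdp_XsubCl /root hornerMn -mulr_natr mulf_eq0.
by rewrite (negPf (charM _ _)) ?orbF // ltnS.
Qed.

Lemma dvdp_prod_XsubC_exp (F : fieldType) (P : {poly F}) (s : seq F) (M : nat) :
  uniq s -> {in s, forall x, ('X - x%:P) ^+ M %| P} ->
  (\prod_(x <- s) ('X - x%:P)) ^+ M %| P.
Proof.
elim: s => [|x s IHs] /=; first by rewrite big_nil expr1n dvd1p.
case/andP=> xs us sP; rewrite big_cons exprMn Gauss_dvdp; last first.
  rewrite coprimep_expl // coprimep_expr // coprimep_sym coprimep_XsubC.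
  by rewrite root_prod_XsubC.
by rewrite sP ?mem_head // IHs // => y ys; rewrite sP // inE ys orbT.
Qed.

(** Applied to powers of ['X^p], which are constants for the derivation in characteristic [p]; this
    is why the auxiliary polynomial can have a large degree and derivatives that stay simple. *)
Lemma derivnMl_const (F : fieldType) (c Q : {poly F}) (n : nat) :
  c^`() = 0 -> (c * Q)^`(n) = c * Q^`(n).
Proof.
by move=> c0; elim: n => // n IHn; rewrite !derivnS IHn derivM c0 mul0r add0r.
Qed.

Section Stepanov.
Variables (p J : nat) (f : {poly 'F_p}) (eps : 'F_p).
Hypotheses (p_prime : prime p) (p_odd : odd p) (f_cubic : size f = 4).
Hypotheses (J_gt0 : (0 < J)%N) (eps0 : eps != 0).

Let h := p./2.
Let M := (2 * J).-1.
Let D := (3 * M * J.-1)%N.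
Hypothesis D_small : (2 * D + 3 < p)%N.
Hypothesis M_small : (M <= p)%N.

Let U : finType := ('I_J * 'I_D.+1 * bool)%type.
Let n (k : 'I_M) := (D + J + 2 * k)%N.
Let T : finType := {k : 'I_M & 'I_(n k)}.

(* A combination [P] of the [e u] vanishes to order [M] at the [x] with
   [f.[x] ^+ h = eps] once the polynomials [R k u], [k < M], satisfy the same
   linear relation: there [x ^+ p = x], so [f ^+ k * P^`(k)] agrees with the
   combination of the [R k u], of much smaller degree.  [D] is large enough for
   the unknowns to outnumber the equations; since [f] has odd degree the [e u]
   have distinct degrees, so [P] is nonzero. *)
Let e (u : U) : {poly 'F_p} := 'X^(u.1.1 * p + u.1.2) * f ^+ (u.2 * h).
Let R (k : nat) (u : U) : {poly 'F_p} :=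
  'X^(u.1.1) * twisted_deriv f (u.2 * h) k 'X^(u.1.2) * (eps ^+ u.2)%:P.

(** There are [2 J] blocks of [D + 1] unknowns against [M] blocks of slightly more than [D]
    equations, so [M = 2 J - 1] is the largest order for which the count can succeed. With the
    chosen [D] the unknowns exceed the equations by exactly one. *)
Let cardTU : (#|T| < #|U|)%N.
Proof.
rewrite card_tagged !card_prod card_bool !card_ord.
have -> : sumn [seq #|'I_(n k)| | k : 'I_M] = \sum_(k < M) n k.
  by rewrite sumnE big_map enumT; apply: eq_bigr => k _; rewrite card_ord.
have -> : \sum_(k < M) n k = (M * (D + J) + M * M.-1)%N.
  rewrite /n; move: (D + J)%N => c; move: (M) => m.
  elim: m => [|m IHm]; first by rewrite big_ord0.
  by rewrite big_ord_recr /= IHm; case: m {IHm} => [|m] /=; nia.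
rewrite /D /M; case: J J_gt0 => // j _ /=; nia.
Qed.

Let f0 : f != 0. Proof. by rewrite -size_poly_gt0 f_cubic. Qed.

Let size_e u : size (e u) = (u.1.1 * p + u.1.2 + 3 * (u.2 * h)).+1.
Proof.
have fh0 : f ^+ (u.2 * h) != 0 by rewrite expf_neq0.
rewrite /e mulrC size_mulXn // -[size (f ^+ _)]prednK ?size_poly_gt0 //.
by rewrite size_exp f_cubic /= addnS mulnC; congr S; lia.
Qed.

Let e_inj : injective (fun u => size (e u)).
Proof.
move=> [[j i] b] [[j' i'] b']; rewrite !size_e /= => -[eqs].
have ph : p = h.*2.+1 by rewrite /h -[LHS]odd_double_half p_odd.
have iD := ltn_ord i; have iD' := ltn_ord i'.
have p_gt0 : (0 < p)%N by apply: prime_gt0.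
(* Since [p = 2 h + 1], one has [3 h = p + (h - 1)]: the right-hand side is the expansion in base
   [p]. Its low digit determines [b], because [D < h - 1] by [D_small]. *)
have key (a : 'I_J) (c : 'I_D.+1) (d : bool) :
    (a * p + c + 3 * (d * h) = (a + d) * p + (c + d * h.-1))%N.
  by case: d; rewrite /= ?mul1n ?mul0n; nia.
have small (c : 'I_D.+1) (d : bool) : (c + d * h.-1 < p)%N.
  by have := ltn_ord c; case: d; rewrite /= ?mul1n ?mul0n; lia.
have := congr1 (divn^~ p) eqs; have := congr1 (modn^~ p) eqs.
rewrite !key /= !modnMDl !divnMDl // !(modn_small (small _ _)) !(divn_small (small _ _)).
rewrite !addn0 => eqi eqj.
have eqb : b = b'.
  have Dh : (D.+1 < h)%N by lia.
  move: eqi iD iD' Dh; move: (nat_of_ord i) (nat_of_ord i') h => x x' q.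
  move: D => d.
  case: b {eqj eqs}; case: b'; rewrite // ?mul1n ?mul0n ?addn0; lia.
rewrite eqb in eqi eqj *.
by congr (_, _, _); apply: val_inj; [apply: addIn eqj | apply: addIn eqi].
Qed.

Let e_neq0 u : e u != 0.
Proof. by rewrite -size_poly_gt0 size_e. Qed.

Let size_R (k : 'I_M) u : (size (R k u) <= n k)%N.
Proof.
case: u => [[j i] b]; rewrite /R /=; have jJ := ltn_ord j; have iD := ltn_ord i.
have st : (size (twisted_deriv f (b * h) k 'X^i) <= D.+1 + 2 * k)%N.
  by rewrite size_twisted_deriv ?f_cubic // size_polyXn.
apply: leq_trans (size_polyMleq _ _) _.
apply: (@leq_trans (size ('X^j * twisted_deriv f (b * h) k 'X^i))).
  by rewrite size_polyC; case: (_ != _); rewrite ?addn0 ?addn1 ?leq_pred /=.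
by apply: leq_trans (size_polyMleq _ _) _; rewrite size_polyXn /n; lia.
Qed.

Let expFp (x : 'F_p) : x ^+ p = x.
Proof. by have := expf_card x; rewrite card_Fp. Qed.

Let horner_derivn_e (x : 'F_p) (k : nat) u : f.[x] ^+ h = eps ->
  f.[x] ^+ k * (e u)^`(k).[x] = (R k u).[x].
Proof.
move=> fx; case: u => [[j i] b]; rewrite /e /R /= exprD -mulrA.
rewrite derivnMl_const; last first.
  by rewrite derivXn -scaler_nat natrM pchar_Fp_0 // mulr0 scale0r.
have := congr1 (horner^~ x) (twisted_derivE f 'X^i (b * h) k).
rewrite !hornerM !horner_exp hornerX hornerC => eqk.
rewrite mulrCA eqk mulnC exprM expFp [(b * h)%N]mulnC exprM fx.
by rewrite mulrA.
Qed.

(** The nonzero polynomial [P] has a zero of order [M] at each counted point, so its degree bounds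
    [M] times their number. After division by [M] the leading term is [p / 2 + p / (2 J - 1)], close
    to equidistribution when [J] is large. *)
Lemma stepanov_bound :
  (M * #|[set x | f.[x] ^+ h == eps]| <= J.-1 * p + 3 * h + D)%N.
Proof.
have [v [[u0 vu0] vL]] :=
  dependent_family (fun u (t : T) => (R (tag t) u)`_(tagged t)) cardTU.
have R0 k : (k < M)%N -> \sum_u v u *: R k u = 0.
  move=> kM; pose k' := Ordinal kM; apply/polyP => i; rewrite coef0 coef_sum.
  have [ni|i_n] := leqP (n k') i.
    rewrite big1 // => u _; rewrite coefZ nth_default ?mulr0 //.
    by apply: leq_trans ni; apply: (size_R k').
  rewrite -[RHS](vL (Tagged (fun k : 'I_M => 'I_(n k)) (Ordinal i_n))).
  by apply: eq_bigr => u _; rewrite coefZ.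
pose P := \sum_u v u *: e u.
have P0 : P != 0 by apply: lincomb_neq0 vu0.
set S := [set x | _].
have h_gt0 : (0 < h)%N by rewrite /h; lia.
have dvdP : (\prod_(x <- enum S) ('X - x%:P)) ^+ M %| P.
  apply: dvdp_prod_XsubC_exp (enum_uniq _) _ => x; rewrite mem_enum inE => /eqP fx.
  apply: dvdp_XsubC_exp => [m /andP[m_gt0 mM]|k kM].
    rewrite -(dvdn_pcharf (pchar_Fp p_prime)) gtnNdvd //.
    exact: leq_trans mM M_small.
  have fx0 : f.[x] ^+ k != 0.
    apply: expf_neq0; apply: contraNneq eps0 => fx0.
    by rewrite -fx fx0 expr0n eqn0Ngt h_gt0.
  apply: (mulfI fx0); rewrite mulr0 /P linear_sum /= horner_sum mulr_sumr.
  have := congr1 (horner^~ x) (R0 k kM); rewrite horner0 horner_sum => Rx.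
  rewrite -[RHS]Rx.
  apply: eq_bigr => u _; rewrite linearZ /= !hornerZ mulrCA.
  by rewrite (horner_derivn_e _ _ fx).
have := dvdp_leq P0 dvdP; rewrite -[X in (X <= _)%N]prednK; last first.
  by rewrite size_poly_gt0 expf_neq0 // monic_neq0 // monic_prod_XsubC.
rewrite size_exp size_prod_XsubC /= -cardE mulnC => sP.
rewrite -ltnS; apply: leq_trans sP _; apply: leq_trans (size_sum _ _ _) _.
apply/bigmax_leqP => -[[j i] b] _; apply: leq_trans (size_scale_leq _ _) _.
have jp : (j * p <= J.-1 * p)%N.
  by rewrite leq_mul2r -ltnS prednK // ltn_ord orbT.
have bh : (b * h <= h)%N by case: b; rewrite ?mul1n ?mul0n.
by rewrite size_e /= ltnS addnAC; do ?apply: leq_add; rewrite ?leq_mul2l ?bh ?leq_ord.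
Qed.

End Stepanov.

(** * Sums of the quadratic character *)

(** The substitution [x = a + 1/z] sends the root [a] to infinity. Multiplying by an even power of
    [z], invisible to the quadratic character, leaves a polynomial of one degree less. *)
Lemma quadratic_inversion (F : fieldType) (c a b z : F) : z != 0 -> a - b != 0 ->
  z ^+ 2 * (z^-1 * (c * (a + z^-1 - b))) = c * (a - b) * (z - - (a - b)^-1).
Proof. by move=> z0 ab0; field; rewrite z0 ab0. Qed.

Lemma quartic_inversion (F : fieldType) (c a b1 b2 b3 z : F) :
  z != 0 -> a - b1 != 0 -> a - b2 != 0 -> a - b3 != 0 ->
  (z ^+ 2) ^+ 2 * (z^-1 * (c * ((a + z^-1 - b1) * (a + z^-1 - b2) * (a + z^-1 - b3)))) =
  c * (a - b1) * (a - b2) * (a - b3) *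
    ((z - - (a - b1)^-1) * (z - - (a - b2)^-1) * (z - - (a - b3)^-1)).
Proof. by move=> z0 d1 d2 d3; field; rewrite z0 d1 d2 d3. Qed.

(** The Legendre symbol by Euler's criterion, with values in [int] so that its sums can be compared
    with [p]. *)
Definition qchar (p : nat) (x : 'F_p) : int :=
  if x == 0 then 0 else if x ^+ p./2 == 1 then 1 else -1.

Section QuadraticCharacter.
Variable p : nat.
Hypotheses (p_prime : prime p) (p_odd : odd p).
Implicit Types x y : 'F_p.

Lemma natF_neq0 (n : nat) : (0 < n < p)%N -> n%:R != 0 :> 'F_p.
Proof.
by move=> /andP[n_gt0 np]; rewrite -(dvdn_pcharf (pchar_Fp p_prime)) gtnNdvd.
Qed.

Lemma half_prime_gt0 : (0 < p./2)%N.
Proof. by have := prime_gt1 p_prime; case: (p) p_odd => [|[|[|q]]]. Qed.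

Lemma two_neq0 : 2 != 0 :> 'F_p.
Proof. by rewrite natF_neq0 //=; have := prime_gt1 p_prime; case: (p) p_odd => [|[|[|q]]]. Qed.

Lemma oppr1_neq1 : (-1 == 1 :> 'F_p) = false.
Proof. by rewrite eq_sym -subr_eq0 opprK (negPf two_neq0). Qed.

Lemma exp_half_sqr x : x != 0 -> (x ^+ 2) ^+ p./2 = 1.
Proof.
move=> x0; apply: (mulfI x0); rewrite mulr1 -exprM -exprS mul2n.
have := expf_card x; rewrite card_Fp // => xp; rewrite -[RHS]xp; congr (_ ^+ _).
by rewrite -[RHS]odd_double_half p_odd.
Qed.

Lemma exp_halfP x : x != 0 -> x ^+ p./2 = 1 \/ x ^+ p./2 = -1.
Proof.
move=> x0; have := exp_half_sqr x0; rewrite exprAC => /eqP.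
by rewrite sqrf_eq1 => /orP[/eqP|/eqP]; [left|right].
Qed.

Lemma qchar0 : qchar (0 : 'F_p) = 0.
Proof. by rewrite /qchar eqxx. Qed.

(** Turns a character sum into the difference of two counts of the kind bounded by [stepanov_bound].
    At [0] both indicators vanish because the exponent is positive. *)
Lemma qcharE x :
  qchar x = (x ^+ p./2 == 1 : nat)%:Z - (x ^+ p./2 == -1 : nat)%:Z.
Proof.
rewrite /qchar; have [->|x0] := eqVneq x 0.
  by rewrite expr0n gtn_eqF ?half_prime_gt0 // !(eq_sym 0) oppr_eq0 oner_eq0.
by case: (exp_halfP x0) => ->; rewrite eqxx ?oppr1_neq1 // eq_sym oppr1_neq1.
Qed.

Lemma qcharM x y : qchar (x * y) = qchar x * qchar y.
Proof.
have [->|x0] := eqVneq x 0; first by rewrite mul0r qchar0 mul0r.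
have [->|y0] := eqVneq y 0; first by rewrite mulr0 qchar0 mulr0.
rewrite /qchar mulf_eq0 (negPf x0) (negPf y0) exprMn.
case: (exp_halfP x0) => ->; case: (exp_halfP y0) => ->;
  by rewrite ?mulrNN ?mul1r ?mulr1 ?eqxx ?oppr1_neq1.
Qed.

Lemma qchar_sqr x : x != 0 -> qchar (x ^+ 2) = 1.
Proof. by move=> x0; rewrite /qchar expf_eq0 (negPf x0) exp_half_sqr // eqxx. Qed.

Lemma qcharN1_nonsquare x y : qchar x = -1 -> y ^+ 2 != x.
Proof.
move=> qx; apply/eqP => yx; rewrite -yx in qx.
have [y0|y0] := eqVneq y 0; first by rewrite y0 expr0n qchar0 in qx.
by rewrite qchar_sqr in qx.
Qed.

Lemma qchar_cases x : x != 0 -> qchar x = 1 \/ qchar x = -1.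
Proof. by rewrite /qchar => /negPf ->; case: ifP; [left|right]. Qed.

Lemma qchar_norm_le1 x : `|qchar x| <= 1.
Proof. by rewrite /qchar; case: ifP => // _; case: ifP. Qed.

Lemma qchar_sqrM c x : c != 0 -> qchar (c ^+ 2 * x) = qchar x.
Proof. by move=> c0; rewrite qcharM qchar_sqr // mul1r. Qed.

(** Otherwise all [p - 1] nonzero elements would be roots of ['X^(p./2) - 1]. *)
Lemma nonresidue_exists : exists n : 'F_p, qchar n = -1.
Proof.
have [/existsP[n /eqP]|/existsPn allsq] := boolP [exists n : 'F_p, qchar n == -1].
  by exists n.
pose q : {poly 'F_p} := 'X^(p./2) - 1.
have sq : size q = p./2.+1 by rewrite size_XnsubC ?half_prime_gt0.
have q0 : q != 0 by rewrite -size_poly_gt0 sq.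
have rootsq : all (root q) (enum (predC1 (0 : 'F_p))).
  apply/allP => x; rewrite mem_enum inE => x0; rewrite /root !hornerE.
  have := allsq x; rewrite /qchar (negPf x0).
  by case: (x ^+ p./2 =P 1) => [->|_]; rewrite ?subrr ?eqxx.
have := max_poly_roots q0 rootsq (enum_uniq _).
rewrite sq -cardE cardC1 card_Fp // ltnS => lt1.
by have := half_prime_gt0; have := odd_double_half p; lia.
Qed.

Lemma sum_qchar : \sum_(x : 'F_p) qchar x = 0.
Proof.
have [n qn] := nonresidue_exists.
have n0 : n != 0 by apply: contraPneq qn => ->; rewrite qchar0.
have : \sum_(x : 'F_p) qchar x = - \sum_(x : 'F_p) qchar x.
  rewrite [LHS](reindex_inj (mulfI n0)) -sumrN; apply: eq_bigr => x _.
  by rewrite qcharM qn mulN1r.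
by move/eqP; rewrite -addr_eq0 -mulr2n mulrn_eq0 => /eqP.
Qed.

Lemma sum_qchar_linear (a b : 'F_p) : a != 0 -> \sum_x qchar (a * (x - b)) = 0.
Proof.
move=> a0; rewrite -[RHS]sum_qchar [RHS](reindex_inj (mulfI a0)).
by rewrite [RHS](reindex_inj (addIr (- b))).
Qed.

(** The square factor matters only at [x = 0], where it replaces a term of absolute value at most 1
    by zero. *)
Lemma sum_qchar_sqr_norm (g : 'F_p -> 'F_p) :
  `|\sum_x qchar (x ^+ 2 * g x)| <= `|\sum_x qchar (g x)| + 1.
Proof.
rewrite (bigD1 0) //= expr0n mul0r qchar0 add0r.
rewrite (eq_bigr (fun x => qchar (g x))) => [|x x0]; last exact: qchar_sqrM.
rewrite [X in `|X| + 1](bigD1 0) //=; set A := \sum_(i | _) _.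
by have := qchar_norm_le1 (g 0); move: A (qchar _) => A q; lia.
Qed.

(** Reindexing by [x = a + z^-1] is a bijection thanks to the convention that the inverse of [0] is
    [0]: the point [z = 0] corresponds to [x = a], where the summand vanishes. The extra 1 pays for
    the value of the new summand at [z = 0]. *)
Lemma sum_qchar_invert (a : 'F_p) (g g' : 'F_p -> 'F_p) :
  (forall z, z != 0 -> qchar (z^-1 * g (a + z^-1)) = qchar (g' z)) ->
  `|\sum_x qchar ((x - a) * g x)| <= `|\sum_x qchar (g' x)| + 1.
Proof.
move=> gg'; rewrite (reindex_inj (addrI a)) (reindex_inj invr_inj) /=.
rewrite (bigD1 0) //= invr0 addr0 subrr mul0r qchar0 add0r.
rewrite (eq_bigr (fun x => qchar (g' x))) => [|x x0]; last first.
  by rewrite [a + _]addrC addrK [_ + a]addrC gg'.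
rewrite [X in `|X| + 1](bigD1 0) //=; set A := \sum_(i | _) _.
by have := qchar_norm_le1 (g' 0); move: A (qchar _) => A q; lia.
Qed.

(* [stepanov_bound] with [J = 16], that is [M = 31] and [D = 1395]. *)
Lemma sum_qchar_cubic (c a1 a2 a3 : 'F_p) : c != 0 -> (2793 < p)%N ->
  31 * `|\sum_x qchar (c * ((x - a1) * (x - a2) * (x - a3)))| <= 2 * p%:Z + 2883.
Proof.
move=> c0 p_large.
pose f : {poly 'F_p} := c *: (('X - a1%:P) * ('X - a2%:P) * ('X - a3%:P)).
have f0 : f != 0 by rewrite scaler_eq0 negb_or c0 !mulf_neq0 ?polyXsubC_eq0.
have sf : size f = 4%N.
  rewrite size_scale // !size_Mmonic ?monicMl ?monicXsubC ?mulf_neq0 ?polyXsubC_eq0 //.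
  by rewrite !size_XsubC.
have fE x : f.[x] = c * ((x - a1) * (x - a2) * (x - a3)) by rewrite !hornerE.
pose N e := #|[set x | f.[x] ^+ p./2 == e]|.
have sN e : e != 0 -> (31 * N e <= 15 * p + 3 * p./2 + 3 * 31 * 15)%N.
  by move=> e0; apply: (@stepanov_bound p 16 f e) => //=; lia.
have sumN e : \sum_x (f.[x] ^+ p./2 == e : nat)%:Z = (N e)%:Z.
  rewrite /N -sum1_card [in RHS]big_mkcond [RHS](big_morph Posz PoszD (erefl _)).
  by apply: eq_bigr => x _; rewrite inE; case: ifP.
have roots3 : (#|[set x | f.[x] == 0%R]| <= 3)%N.
  have rootf : all (root f) (enum [set x | f.[x] == 0]).
    by apply/allP => x; rewrite mem_enum inE.
  by have := max_poly_roots f0 rootf (enum_uniq _); rewrite sf -cardE.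
(* Upper bounds for both signs suffice: the two counts and at most three zeros add up to [p], so an
   upper bound for one count is a lower bound for the other. *)
have total : (N 1%R + N (-1)%R + #|[set x | f.[x] == 0%R]| = p)%N.
  rewrite -[RHS](card_Fp p_prime) -sum1_card /N -!sum1_card.
  rewrite !(big_mkcond (fun x => x \in _)) -!big_split /=; apply: eq_bigr => x _.
  rewrite !inE; have [->|fx0] := eqVneq f.[x] 0.
    by rewrite expr0n gtn_eqF ?half_prime_gt0 // !(eq_sym 0) oppr_eq0 oner_eq0.
  by case: (exp_halfP fx0) => ->; rewrite eqxx ?oppr1_neq1 // eq_sym oppr1_neq1.
have N1 := sN 1 (oner_neq0 _).
have NN1 : (31 * N (-1)%R <= 15 * p + 3 * p./2 + 3 * 31 * 15)%N.
  by apply: sN; rewrite oppr_eq0 oner_neq0.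
rewrite (eq_bigr (fun x => (f.[x] ^+ p./2 == 1 : nat)%:Z - (f.[x] ^+ p./2 == -1 : nat)%:Z)).
  rewrite sumrB !sumN; have := odd_double_half p; rewrite p_odd; lia.
by move=> x _; rewrite -fE qcharE.
Qed.

Lemma sum_qchar_quadratic (c a b : 'F_p) : c != 0 -> a != b ->
  `|\sum_x qchar (c * ((x - a) * (x - b)))| <= 1.
Proof.
move=> c0 ab; have ab0 : a - b != 0 by rewrite subr_eq0.
rewrite (eq_bigr (fun x => qchar ((x - a) * (c * (x - b))))) => [|x _]; last by congr qchar; ring.
apply: le_trans (@sum_qchar_invert a _ (fun z => c * (a - b) * (z - - (a - b)^-1)) _) _.
  by move=> z z0; rewrite -[LHS](@qchar_sqrM z) // quadratic_inversion.
by rewrite sum_qchar_linear ?mulf_neq0.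
Qed.

(** The degree argument in [stepanov_bound] is tied to an odd degree. Inversion at the root [a]
    makes the quartic a cubic with roots [- (a - b)^-1], at the cost of one unit, which becomes 31
    after scaling. *)
Lemma sum_qchar_quartic (c a b1 b2 b3 : 'F_p) : c != 0 -> (2793 < p)%N ->
  a != b1 -> a != b2 -> a != b3 ->
  31 * `|\sum_x qchar (c * ((x - a) * (x - b1) * (x - b2) * (x - b3)))|
    <= 2 * p%:Z + 2883 + 31.
Proof.
move=> c0 p_large ab1 ab2 ab3.
have d1 : a - b1 != 0 by rewrite subr_eq0.
have d2 : a - b2 != 0 by rewrite subr_eq0.
have d3 : a - b3 != 0 by rewrite subr_eq0.
rewrite (eq_bigr (fun x => qchar ((x - a) * (c * ((x - b1) * (x - b2) * (x - b3))))));
  last by move=> x _; congr qchar; ring.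
pose g z := c * (a - b1) * (a - b2) * (a - b3) *
  ((z - - (a - b1)^-1) * (z - - (a - b2)^-1) * (z - - (a - b3)^-1)).
have gE z : z != 0 ->
    qchar (z^-1 * (c * ((a + z^-1 - b1) * (a + z^-1 - b2) * (a + z^-1 - b3)))) = qchar (g z).
  by move=> z0; rewrite -[LHS](@qchar_sqrM (z ^+ 2)) ?expf_neq0 // quartic_inversion.
have /= := @sum_qchar_invert a (fun x => c * ((x - b1) * (x - b2) * (x - b3))) g gE.
have c'0 : c * (a - b1) * (a - b2) * (a - b3) != 0.
  exact: mulf_neq0 (mulf_neq0 (mulf_neq0 c0 d1) d2) d3.
have := sum_qchar_cubic (- (a - b1)^-1) (- (a - b2)^-1) (- (a - b3)^-1) c'0 p_large.
rewrite -/g.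
by move: (\sum_x _) (\sum_x _) => A B; clear; lia.
Qed.
End QuadraticCharacter.

(** * Inversion composed with a four-cycle *)

Lemma ap_destroyingI (G : zmodType) (pi : G -> G) :
  bijective pi ->
  (forall a b c, a + c = b + b -> c != b -> pi a + pi c != pi b + pi b) ->
  ap_destroying pi.
Proof.
move=> pi_bij pi_ap; split=> // -[a [b [c [/esym/eqP abc cb /esym/eqP piabc]]]].
rewrite subr_eq in abc; rewrite subr_eq in piabc.
have cDb : c != b by apply/eqP => eq_cb; apply: cb; rewrite eq_cb subrr.
have /eqP[] : pi a + pi c != pi b + pi b.
  by apply: pi_ap cDb; rewrite (eqP abc) addrA [a + _]addrC subrK.
by rewrite (eqP piabc) addrA [pi a + _]addrC subrK.
Qed.

(* The first line vanishes if [t] is not distinct from [0, 2, 3], the second if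
   [t] forms a progression with two of them, the rest if a progression with
   exactly two terms among [0, 2, t, 3] is preserved. *)
Definition excluded (R : pzRingType) (t : R) : R :=
  t * (t - 2) * (t - 3) *
  ((t - 4) * (t + 2) * (t - 1) * (t - 6) * (t + 3) * (2 * t - 3) * (2 * t - 5)) *
  ((3 * t - 8) * (3 * t - 2) * (t + 4) * (2 * t + 3) * (4 * t - 9) * (t - 9) *
   (4 * t - 5) * (5 * t - 24)) *
  ((4 * t ^+ 2 - 13 * t + 6) * (t ^+ 2 - 13 * t + 24)).

(* Discriminants of the equations expressing that a progression whose only term
   among [0, 2, t, 3] is [2] or [t] is preserved. *)
Definition discriminants (R : pzRingType) (t : R) : seq R :=
  [:: 2 * (2 - t); (2 - t) * (2 - 9 * t); t * (t - 3); (t - 3) * (t - 27)].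

Definition good_parameter (F : fieldType) (t : F) : Prop :=
  excluded t != 0 /\ {in discriminants t, forall x d : F, d ^+ 2 != x}.

(** The tool of the case analysis: [k] is, up to a constant, the common denominator of [x - y], so
    [field] can check the identity and reduce the claim to an inequality known for [t]. *)
Lemma neq_scale (F : fieldType) (k l r x y : F) :
  l != r -> k * (x - y) = l - r -> x != y.
Proof.
by move=> lr kxy; apply: contraNneq lr => xy; rewrite -subr_eq0 -kxy xy subrr mulr0.
Qed.

Section Inversion.
Variable F : finFieldType.
Variable t : F.
Hypotheses (two_neq0 : 2 != 0 :> F) (three_neq0 : 3 != 0 :> F) (five_neq0 : 5 != 0 :> F).
Hypothesis good_t : good_parameter t.

Let excluded_neq0 : excluded t != 0. Proof. by case: good_t. Qed.
Let nonsquare2 d : d ^+ 2 != 2 * (2 - t).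
Proof. by case: good_t => _; apply; rewrite !inE eqxx. Qed.
Let nonsquare2' d : d ^+ 2 != (2 - t) * (2 - 9 * t).
Proof. by case: good_t => _; apply; rewrite !inE eqxx orbT. Qed.
Let nonsquaret d : d ^+ 2 != t * (t - 3).
Proof. by case: good_t => _; apply; rewrite !inE eqxx !orbT. Qed.
Let nonsquaret' d : d ^+ 2 != (t - 3) * (t - 27).
Proof. by case: good_t => _; apply; rewrite !inE eqxx !orbT. Qed.

(* If no other point were moved, the value [1/2] at [0] would preserve [(0, 3, 6)]
   and the value [0] at [3] would preserve [(3, 2, 1)]: this is why [3] and [2]
   both belong to the cycle. *)
Definition cycle_inv (x : F) : F := ((tperm 0 2 * tperm 0 t * tperm 0 3)%g x)^-1.

Let neqs : [/\ [&& t != 0, t != 2 & t != 3],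
   [&& t != 4, t != -2, t != 1, t != 6, t != -3, 2 * t != 3 & 2 * t != 5],
   [&& 3 * t != 8, 3 * t != 2, t != -4, 2 * t != -3, 4 * t != 9, t != 9,
       4 * t != 5 & 5 * t != 24] &
   (4 * t ^+ 2 - 13 * t != - 6) && (t ^+ 2 - 13 * t != - 24)].
Proof.
have := excluded_neq0.
rewrite /excluded !mulf_eq0 !negb_or !subr_eq0 !addr_eq0.
rewrite -!andbA; do 20 ?[case/andP => ->]; by move=> ->.
Qed.

Lemma cycle_inv_bij : bijective cycle_inv.
Proof. by apply: bij_comp; [exact: (inv_bij (@invrK _)) | exact: injF_bij perm_inj]. Qed.

Let t0 : t != 0. Proof. by have [/and3P[]] := neqs. Qed.
Let t2 : t != 2. Proof. by have [/and3P[]] := neqs. Qed.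
Let t3 : t != 3. Proof. by have [/and3P[]] := neqs. Qed.
Let two_neq3 : 2 != 3 :> F.
Proof. by rewrite -subr_eq0 (_ : 2 - 3 = -1) ?oppr_eq0 ?oner_eq0 //; ring. Qed.

Let pi := cycle_inv.
Let pi0 : pi 0 = 2^-1.
Proof. by rewrite /pi /cycle_inv !permM tpermL !tpermD // 1?eq_sym. Qed.
Let pi2 : pi 2 = t^-1.
Proof. by rewrite /pi /cycle_inv !permM tpermR tpermL tpermD // 1?eq_sym. Qed.
Let pit : pi t = 3^-1.
Proof. by rewrite /pi /cycle_inv !permM [tperm 0 2 t]tpermD ?tpermR ?tpermL // 1?eq_sym. Qed.
Let pi3 : pi 3 = 0.
Proof.
rewrite /pi /cycle_inv !permM [tperm 0 2 3]tpermD ?[tperm 0 t 3]tpermD ?tpermR ?invr0 //;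
  by rewrite eq_sym.
Qed.
Let piD x : x != 0 -> x != 2 -> x != t -> x != 3 -> pi x = x^-1.
Proof. by move=> *; rewrite /pi /cycle_inv !permM !tpermD // 1?eq_sym. Qed.

Inductive pi_spec (x : F) : F -> F -> Prop :=
| Pi0 : pi_spec x 0 2^-1
| Pi2 : pi_spec x 2 t^-1
| Pit : pi_spec x t 3^-1
| Pi3 : pi_spec x 3 0
| PiD of x != 0 & x != 2 & x != t & x != 3 : pi_spec x x x^-1.

Let piP x : pi_spec x x (pi x).
Proof.
have [->|x0] := eqVneq x 0; first by rewrite pi0; constructor.
have [->|x2] := eqVneq x 2; first by rewrite pi2; constructor.
have [->|xt] := eqVneq x t; first by rewrite pit; constructor.
have [->|x3] := eqVneq x 3; first by rewrite pi3; constructor.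
by rewrite piD //; constructor.
Qed.

Let k4 : 4 != 0 :> F. Proof. by rewrite (_ : 4 = 2 * 2) ?mulf_neq0 //; ring. Qed.

Let not_ap_023 : [/\ 0 + 2 != 3 + 3 :> F, 0 + 3 != 2 + 2 :> F & 2 + 3 != 0 + 0 :> F].
Proof.
split; [apply: (neq_scale (k := -1) k4) | | apply: (neq_scale (k := 1) five_neq0)]; try by ring.
by apply: (neq_scale (k := -1) (oner_neq0 F)); ring.
Qed.

Let not_ap_02t : [/\ 0 + 2 != t + t, 0 + t != 2 + 2 & 2 + t != 0 + 0].
Proof.
have [_ /and5P[t4 tN2 t1 _ _] _ _] := neqs.
split; [apply: (neq_scale (k := - 2^-1) t1) | apply: (neq_scale (k := 1) t4) |
        apply: (neq_scale (k := 1) tN2)]; by field.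
Qed.

Let not_ap_03t : [/\ 0 + 3 != t + t, 0 + t != 3 + 3 & 3 + t != 0 + 0].
Proof.
have [_ /and5P[_ _ _ t6 /and3P[tN3 t32 _]] _ _] := neqs.
split; [apply: (neq_scale (k := - 1) t32) | apply: (neq_scale (k := 1) t6) |
        apply: (neq_scale (k := 1) tN3)]; by field.
Qed.

Let not_ap_23t : [/\ 2 + 3 != t + t, 2 + t != 3 + 3 & 3 + t != 2 + 2].
Proof.
have [_ /and5P[t4 _ t1 _ /and3P[_ _ t52]] _ _] := neqs.
split; [apply: (neq_scale (k := - 1) t52) | apply: (neq_scale (k := 1) t4) |
        apply: (neq_scale (k := 1) t1)]; by field.
Qed.

Let addxx_inj : injective (fun x : F => x + x).
Proof.
move=> x y; rewrite -!mulr2n -[x *+ 2]mulr_natl -[y *+ 2]mulr_natl.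
exact: mulfI two_neq0 x y.
Qed.

Lemma not_ap_moved a b c : a \in [:: 0; 2; t; 3] -> b \in [:: 0; 2; t; 3] ->
  c \in [:: 0; 2; t; 3] -> c != b -> a + c != b + b.
Proof.
have [? ? ?] := not_ap_023; have [? ? ?] := not_ap_02t.
have [? ? ?] := not_ap_03t; have [? ? ?] := not_ap_23t.
move=> aS bS cS cb; have [->|ab] := eqVneq a b.
  by rewrite (inj_eq (addrI b)).
have [->|ac] := eqVneq a c; first by rewrite (inj_eq addxx_inj).
move: aS bS cS ab ac cb; rewrite !inE.
do 3![case/or4P => /eqP ->]; rewrite ?eqxx // => _ _ _; first [done | by rewrite addrC].
Qed.

Let k6 : 6 != 0 :> F. Proof. by rewrite (_ : 6 = 2 * 3) ?mulf_neq0 //; ring. Qed.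

Let nz := (t0, two_neq0, three_neq0, five_neq0, k4, k6, oppr_eq0, oner_neq0 F).

Lemma not_ap_end_mid a b c : a \in [:: 0; 2; t; 3] -> b \in [:: 0; 2; t; 3] ->
  a + c = b + b -> c != b -> c \notin [:: 0; 2; t; 3] -> pi a + pi c != pi b + pi b.
Proof.
have [_ /and5P[t4 _ _ t6 _] /and5P[t83 t23 tN4 tN32 /and4P[t94 t9 t54 t245]] /andP[q1 q2]] := neqs.
move=> aS bS abc cb cS.
have t4' : 4 - t != 0 by rewrite subr_eq0 eq_sym.
have t6' : 6 - t != 0 by rewrite subr_eq0 eq_sym.
have cE : c = b + b - a by rewrite -abc addrAC subrr add0r.
have ab : a != b by apply: contraNneq cb => eq_ab; rewrite cE eq_ab addrK.
move: (cS); rewrite !inE !negb_or => /and4P[c0 c2 ct c3].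
rewrite (piD c0 c2 ct c3); move: aS bS ab cE c0 {abc c2 ct c3 cS cb}.
rewrite !inE; do 2![case/or4P => /eqP ->]; rewrite ?eqxx ?pi0 ?pi2 ?pit ?pi3 // => _ -> c0;
  rewrite ?subr0 ?sub0r ?add0r in c0 *.
(* The twelve cases are the pairs [(a, b)] of distinct moved points, taken in the order
   [0, 2, t, 3]; each uses one factor of [excluded] or a nonzero constant. *)
- by apply: (neq_scale (k := 4 * t) t83); field; rewrite ?nz ?c0 ?t4' ?t6'.
- by apply: (neq_scale (k := - 6 * t) t3); field; rewrite ?nz ?c0 ?t4' ?t6'.
- by apply: (neq_scale (k := 3) two_neq0); field; rewrite ?nz ?c0 ?t4' ?t6'.
- by apply: (neq_scale (k := - 2 * t) t23); field; rewrite ?nz ?c0 ?t4' ?t6'.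
- by apply: (neq_scale (k := - 3 * t * (2 * t - 2)) q1); field; rewrite ?nz ?c0 ?t4' ?t6'.
- by apply: (neq_scale (k := 4 * t) tN4); field; rewrite ?nz ?c0 ?t4' ?t6'.
- by apply: (neq_scale (k := - 3 * t) tN32); field; rewrite ?nz ?c0 ?t4' ?t6'.
- by apply: (neq_scale (k := - 3 * t * (4 - t)) q2); field; rewrite ?nz ?c0 ?t4' ?t6'.
- by apply: (neq_scale (k := - 3 * (6 - t)) t9); field; rewrite ?nz ?c0 ?t4' ?t6'.
- by apply: (neq_scale (k := -3) k4); field; rewrite ?nz ?c0 ?t4' ?t6'.
- by apply: (neq_scale (k := t) t2); field; rewrite ?nz ?c0 ?t4' ?t6'.
- by apply: (neq_scale (k := - 3 * (2 * t - 3)) t94); field; rewrite ?nz ?c0 ?t4' ?t6'.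
Qed.

Lemma not_ap_two_ends a b c : a \in [:: 0; 2; t; 3] -> c \in [:: 0; 2; t; 3] ->
  a + c = b + b -> c != b -> b \notin [:: 0; 2; t; 3] -> pi a + pi c != pi b + pi b.
Proof.
have [_ /and5P[_ _ t1 t6 _] /and5P[t83 t23 tN4 tN32 /and4P[t94 t9 t54 t245]] _] := neqs.
move=> aS cS abc cb bS.
(* With ends [2] and [t] the condition is [t^2 - 7 t + 6 = 0]; it splits into two factors already
   excluded for other reasons. *)
have t16 : (t - 1) * (t - 6) != 0 by rewrite mulf_neq0 ?subr_eq0.
have bE : b = (a + c) / 2 by rewrite abc; field.
have ac : a != c.
  by apply: contraNneq cb => eq_ac; rewrite bE eq_ac -mulr2n -[c *+ 2]mulr_natr mulfK.
move: (bS); rewrite !inE !negb_or => /and4P[b0 b2 bt b3].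
rewrite (piD b0 b2 bt b3); have ac0 : a + c != 0.
  by apply: contraNneq b0 => ac0; rewrite bE ac0 mul0r.
move: aS cS ac ac0 bE {abc b0 b2 bt b3 bS cb}.
rewrite !inE; do 2![case/or4P => /eqP ->]; rewrite ?eqxx ?pi0 ?pi2 ?pit ?pi3 // => _ ac0 ->;
  rewrite ?addr0 ?add0r in ac0 *.
- by apply: (neq_scale (k := -2 * t) t23); field; rewrite ?nz ?ac0 ?[t + 3]addrC ?ac0.
- by apply: (neq_scale (k := 6 * t) t245); field; rewrite ?nz ?ac0 ?[t + 3]addrC ?ac0.
- by apply: (neq_scale (k := -6) five_neq0); field; rewrite ?nz ?ac0 ?[t + 3]addrC ?ac0.
- by apply: (neq_scale (k := -2 * t) t23); field; rewrite ?nz ?ac0 ?[t + 3]addrC ?ac0.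
- by apply: (neq_scale (k := 3 * t * (t + 2)) t16); field; rewrite ?nz ?ac0 ?[t + 2]addrC ?ac0.
- by apply: (neq_scale (k := -5 * t) t54); field; rewrite ?nz ?ac0 ?[t + 3]addrC ?ac0.
- by apply: (neq_scale (k := 6 * t) t245); field; rewrite ?nz ?ac0 ?[t + 3]addrC ?ac0.
- by apply: (neq_scale (k := 3 * t * (t + 2)) t16); field; rewrite ?nz ?ac0 ?[t + 2]addrC ?ac0.
- by apply: (neq_scale (k := 3 * (t+3)) t9); field; rewrite ?nz ?ac0 ?[t + 3]addrC ?ac0.
- by apply: (neq_scale (k := -6) five_neq0); field; rewrite ?nz ?ac0 ?[t + 3]addrC ?ac0.
- by apply: (neq_scale (k := -5 * t) t54); field; rewrite ?nz ?ac0 ?[t + 3]addrC ?ac0.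
- by apply: (neq_scale (k := 3 * (t+3)) t9); field; rewrite ?nz ?ac0 ?[t + 3]addrC ?ac0.
Qed.

Let movedN x : x \notin [:: 0; 2; t; 3] -> x != 0 /\ pi x = x^-1.
Proof. by rewrite !inE !negb_or => /and4P[x0 x2 xt x3]; rewrite piD. Qed.

(** With [d = a - b], preservation means [2 b / (b^2 - d^2) = 2 pi b]. This gives [d^2 = 2 (2 - t)]
    for [b = 2] and [d^2 = t (t - 3)] for [b = t]; for [b = 0] it reads [0 = 1], and for [b = 3] a
    nonzero fraction would vanish. *)
Lemma not_ap_mid a b c : b \in [:: 0; 2; t; 3] -> a \notin [:: 0; 2; t; 3] ->
  c \notin [:: 0; 2; t; 3] -> a + c = b + b -> pi a + pi c != pi b + pi b.
Proof.
move=> bS /movedN[a0 ->] /movedN[c0 ->] abc.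
have cE : c = b + b - a by rewrite -abc addrAC subrr add0r.
rewrite cE in c0 *; move: bS c0; rewrite !inE {c abc cE}.
case/or4P => /eqP ->; rewrite ?pi0 ?pi2 ?pit ?pi3 => c0.
- apply: (neq_scale (k := -1) (oner_neq0 F)); rewrite ?add0r ?sub0r in c0 *.
  by field; rewrite ?nz ?a0.
- apply: (neq_scale (k := t * a * (2 + 2 - a) / 2) (nonsquare2 (a - 2))).
  have c0' : 4 - a != 0 by rewrite (_ : 4 - a = 2 + 2 - a) //; ring.
  by field; rewrite ?nz ?a0 ?c0'.
- apply: (neq_scale (k := 3 * a * (t + t - a) / 2) (nonsquaret (a - t))).
  by field; rewrite ?nz ?a0 ?c0.
- apply: (neq_scale (k := a * (3 + 3 - a)) k6).
  have c0' : 6 - a != 0 by rewrite (_ : 6 - a = 3 + 3 - a) //; ring.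
  by field; rewrite ?nz ?a0 ?c0'.
Qed.

(** With [v = pi a], the equation [v + 1 / (2 b - a) = 2 / b] becomes
    [2 v b^2 - (a v + 3) b + 2 a = 0], of discriminant [(a v + 3)^2 - 16 a v]. For [a = 2] and
    [a = t] this is, up to a square, the second and the fourth entry of [discriminants]. For [a = 0]
    and [a = 3] the only nonzero solution is [3], respectively [2], which is a moved point. *)
Lemma not_ap_end a b c : a \in [:: 0; 2; t; 3] -> b \notin [:: 0; 2; t; 3] ->
  c \notin [:: 0; 2; t; 3] -> a + c = b + b -> pi a + pi c != pi b + pi b.
Proof.
move=> aS bS /movedN[c0 ->] abc.
have [b0 ->] := movedN bS.
have [b2 b3] : b != 2 /\ b != 3 by move: bS; rewrite !inE !negb_or => /and4P[].
have cE : c = b + b - a by rewrite -abc addrAC subrr add0r.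
rewrite cE in c0 *; move: aS c0; rewrite !inE {c abc cE bS}.
case/or4P => /eqP ->; rewrite ?pi0 ?pi2 ?pit ?pi3 => c0.
- rewrite subr0 in c0 *; apply: (neq_scale (k := 2 * b) b3).
  by field; rewrite ?nz ?b0 ?c0.
- apply: (neq_scale (k := 8 * t * b * (b + b - 2)) (nonsquare2' (4 * b - 2 - 3 * t))).
  by field; rewrite ?nz ?b0 ?c0.
- apply: (neq_scale (k := 8 * 3 * b * (b + b - t)) (nonsquaret' (4 * b - (t + 9)))).
  by field; rewrite ?nz ?b0 ?c0.
- apply: (neq_scale (k := - b * (b + b - 3) / 3) b2).
  by field; rewrite ?nz ?b0 ?c0.
Qed.

Lemma not_ap_unmoved a b c : a \notin [:: 0; 2; t; 3] -> b \notin [:: 0; 2; t; 3] ->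
  c \notin [:: 0; 2; t; 3] -> a + c = b + b -> c != b -> pi a + pi c != pi b + pi b.
Proof.
move=> /movedN[a0 ->] /movedN[b0 ->] /movedN[c0 ->] abc cb.
have aE : a = b + b - c by rewrite -abc addrK.
rewrite aE in a0 *; have bc : (b - c) ^+ 2 != 0 by rewrite expf_neq0 // subr_eq0 eq_sym.
apply: (neq_scale (k := b * c * (b + b - c) / 2) bc).
by field; rewrite ?nz ?a0 ?b0 ?c0.
Qed.

Lemma cycle_inv_ap_destroying : ap_destroying cycle_inv.
Proof.
apply: (ap_destroyingI cycle_inv_bij) => a b c abc cb; rewrite -/pi.
have ab : a != b by apply: contraNneq cb => ab; rewrite -(inj_eq (addrI a)) abc ab.
have cba : c + a = b + b by rewrite addrC.
have [aS|aS] := boolP (a \in [:: 0; 2; t; 3]);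
have [bS|bS] := boolP (b \in [:: 0; 2; t; 3]);
have [cS|cS] := boolP (c \in [:: 0; 2; t; 3]).
- by have := not_ap_moved aS bS cS cb; rewrite abc eqxx.
- exact: not_ap_end_mid.
- exact: not_ap_two_ends.
- exact: not_ap_end.
- by rewrite addrC not_ap_end_mid.
- exact: not_ap_mid.
- by rewrite addrC not_ap_end.
- exact: not_ap_unmoved.
Qed.
End Inversion.

(** * Large primes *)

(** Serves twice: to evaluate the polynomial [excluded 'X] at a point, and to reduce modulo [p] a
    value computed in [Z]. *)
Lemma rmorph_excluded (R S : pzRingType) (f : {rmorphism R -> S}) (t : R) :
  f (excluded t) = excluded (f t).
Proof. by rewrite /excluded !(rmorphM, rmorphD, rmorphN, rmorphXn, rmorph_nat, rmorph1). Qed.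

Section Degree.
Variable F : fieldType.
Definition degree_le (n : nat) (q : {poly F}) := (size q <= n.+1)%N.

Lemma degree_leM m n (q r : {poly F}) :
  degree_le m q -> degree_le n r -> degree_le (m + n) (q * r).
Proof.
move=> qm rn; apply: leq_trans (size_polyMleq _ _) _.
by move: qm rn; rewrite /degree_le; lia.
Qed.

Lemma degree_leDn n (q : {poly F}) (k : nat) : degree_le n q -> degree_le n (q + k%:R).
Proof.
move=> qn; apply: leq_trans (size_polyD _ _) _; rewrite geq_max (qn : (_ <= _)%N).
by rewrite -polyC_natr (leq_trans (size_polyC_leq1 _)).
Qed.

Lemma degree_leBn n (q : {poly F}) (k : nat) : degree_le n q -> degree_le n (q - k%:R).
Proof.
move=> qn; apply: leq_trans (size_polyD _ _) _; rewrite geq_max (qn : (_ <= _)%N) size_polyN.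
by rewrite -polyC_natr (leq_trans (size_polyC_leq1 _)).
Qed.

Lemma degree_leB n (q r : {poly F}) : degree_le n q -> degree_le n r -> degree_le n (q - r).
Proof.
move=> qn rn; apply: leq_trans (size_polyD _ _) _.
by rewrite geq_max size_polyN; apply/andP.
Qed.

Lemma degree_leMn n (q : {poly F}) (k : nat) : degree_le n q -> degree_le n (k%:R * q).
Proof.
move=> qn; apply: (@degree_leM 0 n) => //.
by rewrite /degree_le -polyC_natr size_polyC_leq1.
Qed.

Lemma degree_leX : degree_le 1 'X. Proof. by rewrite /degree_le size_polyX. Qed.

(** The degree 22 is made up of [3 + 7 + 8] linear factors and two quadratic ones. *)
Lemma degree_excluded : degree_le 22 (excluded 'X).
Proof.
have dX := degree_leX.
have dX2 : degree_le 2 'X^2 by rewrite /degree_le size_polyXn.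
have dX12 : degree_le 2 'X by rewrite /degree_le size_polyX.
have lin k : degree_le 1 ('X - k%:R) by apply: degree_leBn.
have lin1 : degree_le 1 ('X - 1) by apply: (lin 1%N).
have lin' k : degree_le 1 ('X + k%:R) by apply: degree_leDn.
have linm m k : degree_le 1 (m%:R * 'X - k%:R) by apply/degree_leBn/degree_leMn.
have linm' m k : degree_le 1 (m%:R * 'X + k%:R) by apply/degree_leDn/degree_leMn.
have q1 : degree_le 2 (4 * 'X ^+ 2 - 13 * 'X + 6).
  by apply: degree_leDn; apply: degree_leB; apply: degree_leMn.
have q2 : degree_le 2 ('X ^+ 2 - 13 * 'X + 24).
  by apply: degree_leDn; apply: degree_leB => //; apply: degree_leMn.
apply: (@degree_leM 18 4); last exact: (@degree_leM 2 2).
apply: (@degree_leM 10 8); last first.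
  by apply: (@degree_leM 7 1) => //; apply: (@degree_leM 6 1) => //;
    apply: (@degree_leM 5 1) => //; apply: (@degree_leM 4 1) => //;
    apply: (@degree_leM 3 1) => //; apply: (@degree_leM 2 1) => //;
    apply: (@degree_leM 1 1).
apply: (@degree_leM 3 7); last first.
  by apply: (@degree_leM 6 1) => //; apply: (@degree_leM 5 1) => //;
    apply: (@degree_leM 4 1) => //; apply: (@degree_leM 3 1) => //;
    apply: (@degree_leM 2 1) => //; apply: (@degree_leM 1 1).
by apply: (@degree_leM 2 1) => //; apply: (@degree_leM 1 1).
Qed.
End Degree.

(** * A sign pattern for four polynomials of degree at most two *)

Section Pattern.
Variable F : fieldType.
Hypothesis nine_neq0 : 9 != 0 :> F.
Implicit Types x : F.
(** [f1] and [f3] are the first and third discriminants; [f1 * f2] and [f3 * f4] are square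
    multiples of the second and fourth. Prescribing the characters [-1, 1, -1, 1] thus makes all
    four discriminants nonsquares. *)
Let f1 x := 2 * (2 - x).
Let f2 x := 2 * (2 - 9 * x).
Let f3 x := x * (x - 3).
Let f4 x := x * (x - 27).

(** Brings the fifteen nonempty products to the form required by the character sum bounds. A product
    containing both [f3] and [f4] has a double root at [0], split off as a square, so at most four
    other roots remain. *)
Lemma pattern_split x :
  [/\ f1 x = -2 * (x - 2), f2 x = -18 * (x - 2 / 9),
       f3 x = 1 * ((x - 0) * (x - 3)) & f4 x = 1 * ((x - 0) * (x - 27))] /\
   [/\ f1 x * f2 x = 36 * ((x - 2) * (x - 2 / 9)) &
       f3 x * f4 x = x ^+ 2 * (1 * ((x - 3) * (x - 27)))] /\
   [/\ f1 x * f3 x = -2 * ((x - 2) * (x - 0) * (x - 3)),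
       f1 x * f4 x = -2 * ((x - 2) * (x - 0) * (x - 27)),
       f2 x * f3 x = -18 * ((x - 2 / 9) * (x - 0) * (x - 3)) &
       f2 x * f4 x = -18 * ((x - 2 / 9) * (x - 0) * (x - 27))] /\
   [/\ f1 x * f3 x * f4 x = x ^+ 2 * (-2 * ((x - 2) * (x - 3) * (x - 27))),
       f2 x * f3 x * f4 x = x ^+ 2 * (-18 * ((x - 2 / 9) * (x - 3) * (x - 27))),
       f1 x * f2 x * f3 x = 36 * ((x - 2) * (x - 2 / 9) * (x - 0) * (x - 3)) &
       f1 x * f2 x * f4 x = 36 * ((x - 2) * (x - 2 / 9) * (x - 0) * (x - 27))] /\
   f1 x * f2 x * f3 x * f4 x =
      x ^+ 2 * (36 * ((x - 2) * (x - 2 / 9) * (x - 3) * (x - 27))).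
Proof.
by rewrite /f1 /f2 /f3 /f4; (do !split); field.
Qed.
End Pattern.

Lemma sign_pattern (a b c d : int) :
  (a = 1 \/ a = -1) -> (b = 1 \/ b = -1) -> (c = 1 \/ c = -1) -> (d = 1 \/ d = -1) ->
  [/\ a = -1, b = 1, c = -1 & d = 1] \/ (1 - a) * (1 + b) * (1 - c) * (1 + d) = 0.
Proof.
case=> -> [] -> [] -> [] ->;
  by [left | right; rewrite ?subrr ?addrN ?mul0r ?mulr0 ?mul0r].
Qed.

Lemma mulr_bounds (x y m n : int) : 0 <= x <= m -> 0 <= y <= n -> 0 <= x * y <= m * n.
Proof. by case/andP=> x0 xm /andP[y0 yn]; rewrite mulr_ge0 // ler_pM. Qed.

Lemma pattern_weight_le16 (a b c d : int) :
  `|a| <= 1 -> `|b| <= 1 -> `|c| <= 1 -> `|d| <= 1 ->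
  (1 - a) * (1 + b) * (1 - c) * (1 + d) <= 16.
Proof.
have subr1 (x : int) : `|x| <= 1 -> 0 <= 1 - x <= 2 by lia.
have addr1 (x : int) : `|x| <= 1 -> 0 <= 1 + x <= 2 by lia.
move=> /subr1 a1 /addr1 b1 /subr1 c1 /addr1 d1.
by have /andP[] := mulr_bounds (mulr_bounds (mulr_bounds a1 b1) c1) d1.
Qed.

Lemma sum_pattern_weight (T : finType) (R : pzRingType) (chi : R -> int)
  (f1 f2 f3 f4 : T -> R) (n : nat) :
  #|T| = n -> {morph chi : x y / x * y} ->
  let S g := \sum_x chi (g x) in
  \sum_x (1 - chi (f1 x)) * (1 + chi (f2 x)) * (1 - chi (f3 x)) * (1 + chi (f4 x)) =
  n%:Z - S f1 + S f2 - S f3 + S f4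
   - S (fun x => f1 x * f2 x) + S (fun x => f1 x * f3 x) - S (fun x => f1 x * f4 x)
   - S (fun x => f2 x * f3 x) + S (fun x => f2 x * f4 x) - S (fun x => f3 x * f4 x)
   + S (fun x => f1 x * f2 x * f3 x) - S (fun x => f1 x * f2 x * f4 x)
   + S (fun x => f1 x * f3 x * f4 x) - S (fun x => f2 x * f3 x * f4 x)
   + S (fun x => f1 x * f2 x * f3 x * f4 x).
Proof.
move=> Tn chiM S; rewrite /S.
have -> : n%:Z = \sum_(x : T) 1 by rewrite sumr_const natz Tn.
rewrite -!sumrN -!big_split /=; apply: eq_bigr => x _.
by rewrite !chiM; ring.
Qed.

Lemma degree_excluded_zeros (F : fieldType) :
  degree_le 27 (excluded 'X * (('X - 2) * (9 * 'X - 2) * 'X * ('X - 3) * ('X - 27)) : {poly F}).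
Proof.
apply: (@degree_leM _ 22 5); first exact: degree_excluded.
have dX := degree_leX F.
have lin k : degree_le 1 ('X - k%:R : {poly F}) by apply: degree_leBn.
have linm m k : degree_le 1 (m%:R * 'X - k%:R : {poly F}) by apply/degree_leBn/degree_leMn.
by apply: (@degree_leM _ 4 1) => //; apply: (@degree_leM _ 3 1) => //;
  apply: (@degree_leM _ 2 1) => //; apply: (@degree_leM _ 1 1).
Qed.

Lemma twice_sub_neq0 (F : fieldType) (y : F) : 2 != 0 :> F -> y - 2 != 0 -> 2 * (2 - y) != 0.
Proof. by move=> two0 y2; rewrite mulf_neq0 // -oppr_eq0 opprB. Qed.

(** Shows that the polynomial [Q] of [pattern_exists] is not zero: at [10] every factor is, up to
    sign, a positive integer below 3100. *)
Lemma excluded_zeros_at10 (F : fieldType) :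
  (forall n, (0 < n < 3100)%N -> n%:R != 0 :> F) ->
  forall x : F, x = 10 ->
  excluded x * ((x - 2) * (9 * x - 2) * x * (x - 3) * (x - 27)) != 0.
Proof.
move=> nz x xE.
have -> : excluded x * ((x - 2) * (9 * x - 2) * x * (x - 3) * (x - 27)) =
  10 * 8 * 7 * (6 * 12 * 9 * 4 * 13 * 17 * 15) *
     (22 * 28 * 14 * 23 * 31 * 35 * 26) * (276 * 6) * (8 * 88 * 10 * 7 * 17).
  by rewrite xE /excluded; ring.
by rewrite !mulf_neq0 // nz.
Qed.

(** The nine large sums cost at most [18 p / 31 + 837 + 6] and the four small ones 5; together with
    432 this is [18 p / 31 + 1280], below [p] as soon as [p > 3052]. *)
Lemma pattern_bound (p : nat) (B s1 s2 s3 s4 s12 s34 : int)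
  (s13 s14 s23 s24 s134 s234 s123 s124 s1234 : int) :
  (3100 <= p)%N -> B = 2 * p%:Z + 2883 ->
  s1 = 0 -> s2 = 0 -> `|s3| <= 1 -> `|s4| <= 1 -> `|s12| <= 1 -> `|s34| <= 2 ->
  31 * `|s13| <= B -> 31 * `|s14| <= B -> 31 * `|s23| <= B -> 31 * `|s24| <= B ->
  31 * `|s134| <= B + 31 -> 31 * `|s234| <= B + 31 ->
  31 * `|s123| <= B + 31 -> 31 * `|s124| <= B + 31 -> 31 * `|s1234| <= B + 62 ->
  432 < p%:Z - s1 + s2 - s3 + s4 - s12 + s13 - s14 - s23 + s24 - s34
        + s123 - s124 + s134 - s234 + s1234.
Proof.
have pos k (s C : int) : 0 <= k -> k * `|s| <= C -> k * s <= C.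
  by move=> k0; apply: le_trans; rewrite ler_wpM2l ?ler_norm.
have neg k (s C : int) : 0 <= k -> k * `|s| <= C -> - k * s <= C.
  by move=> k0; rewrite mulNr -mulrN -normrN; apply: pos.
move=> p_large BE -> -> /ler_normlP[_ b3] /ler_normlP[a4 _] /ler_normlP[_ b12] /ler_normlP[_ b34].
move=> /neg-/(_ isT) a13 /pos-/(_ isT) b14 /pos-/(_ isT) b23 /neg-/(_ isT) a24.
move=> /neg-/(_ isT) a134 /pos-/(_ isT) b234 /neg-/(_ isT) a123 /pos-/(_ isT) b124 /neg-/(_ isT) a1234.
have {p_large} : 3100 <= p%:Z by clear -p_large; lia.
rewrite ltNge; apply: contraTN => sum_le; rewrite -ltNge.
by move: p%:Z BE sum_le => q BE sum_le {pos neg}; lra.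
Qed.

Lemma pattern_exists (p : nat) : prime p -> odd p -> (3100 <= p)%N ->
  exists t : 'F_p, [/\ excluded t != 0, qchar (2 * (2 - t)) = -1,
    qchar (2 * (2 - 9 * t)) = 1, qchar (t * (t - 3)) = -1 & qchar (t * (t - 27)) = 1].
Proof.
move=> p_prime p_odd p_large.
have nz n : (0 < n < 3100)%N -> n%:R != 0 :> 'F_p.
  by move=> /andP[n0 n1]; rewrite natF_neq0 // n0 (leq_trans n1).
have p_large' : (2793 < p)%N by lia.
have nz9 : 9 != 0 :> 'F_p by rewrite nz.
have c2 : -2 != 0 :> 'F_p by rewrite oppr_eq0 nz.
have c18 : -18 != 0 :> 'F_p by rewrite oppr_eq0 nz.
have c36 : 36 != 0 :> 'F_p by rewrite nz.
have n1 : 2 != 2 / 9 :> 'F_p by apply: (neq_scale (k := 9) (nz 16%N isT)); field.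
have n2 : 2 != 0 :> 'F_p by rewrite nz.
have n3 : 2 != 3 :> 'F_p by apply: (neq_scale (k := -1) (nz 1%N isT)); ring.
have n4 : 2 != 27 :> 'F_p by apply: (neq_scale (k := -1) (nz 25%N isT)); ring.
have n5 : 0 != 3 :> 'F_p by rewrite eq_sym nz.
have n6 : 0 != 27 :> 'F_p by rewrite eq_sym nz.
have n7 : 3 != 27 :> 'F_p by apply: (neq_scale (k := -1) (nz 24%N isT)); ring.
pose f1 (x : 'F_p) := 2 * (2 - x).
pose f2 (x : 'F_p) := 2 * (2 - 9 * x).
pose f3 (x : 'F_p) := x * (x - 3).
pose f4 (x : 'F_p) := x * (x - 27).
have pat x := pattern_split nz9 x.
pose S (g : 'F_p -> 'F_p) : int := \sum_x qchar (g x).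
have SE g h : (forall x, g x = h x) -> S g = S h.
  by move=> gh; apply: eq_bigr => x _; rewrite gh.
have s1 : S f1 = 0.
  rewrite (SE _ (fun x => -2 * (x - 2))) => [|x]; last by case: (pat x) => [[]].
  exact: sum_qchar_linear.
have s2 : S f2 = 0.
  rewrite (SE _ (fun x => -18 * (x - 2 / 9))) => [|x]; last by case: (pat x) => [[]].
  exact: sum_qchar_linear.
have s3 : `|S f3| <= 1.
  rewrite (SE _ (fun x => 1 * ((x - 0) * (x - 3)))) => [|x]; last by case: (pat x) => [[]].
  exact: sum_qchar_quadratic (oner_neq0 _) n5.
have s4 : `|S f4| <= 1.
  rewrite (SE _ (fun x => 1 * ((x - 0) * (x - 27)))) => [|x]; last by case: (pat x) => [[]].
  exact: sum_qchar_quadratic (oner_neq0 _) n6.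
have s12 : `|S (fun x => f1 x * f2 x)| <= 1.
  rewrite (SE _ (fun x => 36 * ((x - 2) * (x - 2 / 9)))) => [|x]; last by case: (pat x) => [_ [[]]].
  exact: sum_qchar_quadratic.
have s34 : `|S (fun x => f3 x * f4 x)| <= 2.
  rewrite (SE _ (fun x => x ^+ 2 * (1 * ((x - 3) * (x - 27))))) => [|x]; last by case: (pat x) => [_ [[]]].
  apply: le_trans (sum_qchar_sqr_norm p_prime p_odd _) _.
  by rewrite (lerD2r 1 _ 1) (sum_qchar_quadratic p_prime p_odd (oner_neq0 _) n7).
have cub c a1 a2 a3 g : c != 0 -> (forall x, g x = c * ((x - a1) * (x - a2) * (x - a3))) ->
    31 * `|S g| <= 2 * p%:Z + 2883.
  by move=> c0 gE; rewrite (SE _ _ gE); apply: sum_qchar_cubic.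
have cub2 c a1 a2 a3 g : c != 0 ->
    (forall x, g x = x ^+ 2 * (c * ((x - a1) * (x - a2) * (x - a3)))) ->
    31 * `|S g| <= 2 * p%:Z + 2883 + 31.
  move=> c0 gE; rewrite (SE _ _ gE).
  have := sum_qchar_sqr_norm p_prime p_odd (fun x => c * ((x - a1) * (x - a2) * (x - a3))).
  have := sum_qchar_cubic p_prime p_odd a1 a2 a3 c0 p_large'.
  by rewrite /S; move: `|_| `|_| => A B; clear; lia.
have qua c a b1 b2 b3 g : c != 0 -> a != b1 -> a != b2 -> a != b3 ->
    (forall x, g x = c * ((x - a) * (x - b1) * (x - b2) * (x - b3))) ->
    31 * `|S g| <= 2 * p%:Z + 2883 + 31.
  by move=> c0 ab1 ab2 ab3 gE; rewrite (SE _ _ gE); apply: sum_qchar_quartic.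
have s13 : 31 * `|S (fun x => f1 x * f3 x)| <= 2 * p%:Z + 2883.
  by apply: cub c2 _ => x; case: (pat x) => [_ [_ [[e _ _ _] _]]]; apply: e.
have s14 : 31 * `|S (fun x => f1 x * f4 x)| <= 2 * p%:Z + 2883.
  by apply: cub c2 _ => x; case: (pat x) => [_ [_ [[_ e _ _] _]]]; apply: e.
have s23 : 31 * `|S (fun x => f2 x * f3 x)| <= 2 * p%:Z + 2883.
  by apply: cub c18 _ => x; case: (pat x) => [_ [_ [[_ _ e _] _]]]; apply: e.
have s24 : 31 * `|S (fun x => f2 x * f4 x)| <= 2 * p%:Z + 2883.
  by apply: cub c18 _ => x; case: (pat x) => [_ [_ [[_ _ _ e] _]]]; apply: e.
have s134 : 31 * `|S (fun x => f1 x * f3 x * f4 x)| <= 2 * p%:Z + 2883 + 31.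
  by apply: cub2 c2 _ => x; case: (pat x) => [_ [_ [_ [[e _ _ _] _]]]]; apply: e.
have s234 : 31 * `|S (fun x => f2 x * f3 x * f4 x)| <= 2 * p%:Z + 2883 + 31.
  by apply: cub2 c18 _ => x; case: (pat x) => [_ [_ [_ [[_ e _ _] _]]]]; apply: e.
have s123 : 31 * `|S (fun x => f1 x * f2 x * f3 x)| <= 2 * p%:Z + 2883 + 31.
  by apply: qua c36 n1 n2 n3 _ => x; case: (pat x) => [_ [_ [_ [[_ _ e _] _]]]]; apply: e.
have s124 : 31 * `|S (fun x => f1 x * f2 x * f4 x)| <= 2 * p%:Z + 2883 + 31.
  by apply: qua c36 n1 n2 n4 _ => x; case: (pat x) => [_ [_ [_ [[_ _ _ e] _]]]]; apply: e.
have s1234 : 31 * `|S (fun x => f1 x * f2 x * f3 x * f4 x)| <= 2 * p%:Z + 2883 + 62.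
  rewrite (SE _ (fun x => x ^+ 2 * (36 * ((x - 2) * (x - 2 / 9) * (x - 3) * (x - 27))))) => [|x];
    last by case: (pat x) => [_ [_ [_ [_ e]]]]; apply: e.
  have := sum_qchar_sqr_norm p_prime p_odd (fun x => 36 * ((x - 2) * (x - 2 / 9) * (x - 3) * (x - 27))).
  have := sum_qchar_quartic p_prime p_odd c36 p_large' n1 n3 n4.
  by rewrite /S; move: `|_| `|_| => A B; clear; lia.
(* [w x] vanishes off the zeros of [Q] unless [x] has the required pattern. *)
pose w x : int := (1 - qchar (f1 x)) * (1 + qchar (f2 x)) * (1 - qchar (f3 x)) * (1 + qchar (f4 x)).
have sum_w := sum_pattern_weight f1 f2 f3 f4 (card_Fp p_prime) (qcharM p_prime p_odd).
pose Q : {poly 'F_p} := excluded 'X * (('X - 2) * (9 * 'X - 2) * 'X * ('X - 3) * ('X - 27)).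
have QE x : Q.[x] = excluded x * ((x - 2) * (9 * x - 2) * x * (x - 3) * (x - 27)).
  rewrite -[LHS]/(horner_eval x Q) /Q rmorphM /= rmorph_excluded.
  by rewrite !(rmorphM, rmorphB, rmorph_nat) /= /horner_eval hornerX.
have Q0 : Q != 0.
  apply/eqP => Q0; have := excluded_zeros_at10 nz (erefl _).
  by rewrite -QE Q0 horner0 eqxx.
have sQ : (size Q <= 28)%N by apply: degree_excluded_zeros.
pose B := [set x | Q.[x] == 0].
have B_small : (#|B| <= 27)%N.
  have rootB : all (root Q) (enum B) by apply/allP => x; rewrite mem_enum inE.
  by have := max_poly_roots Q0 rootB (enum_uniq _); rewrite -cardE => /leq_trans/(_ sQ).
have [/existsP[t /and5P[t1 t2 t3 t4 t5]]|/existsPn none] := boolP [exists t : 'F_p,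
  [&& excluded t != 0, qchar (f1 t) == -1, qchar (f2 t) == 1, qchar (f3 t) == -1
    & qchar (f4 t) == 1]].
  by exists t; exact: And5 t1 (eqP t2) (eqP t3) (eqP t4) (eqP t5).
have w_le x : w x <= if x \in B then 16 else 0.
  case: ifP => [_|/negbT]; first by apply: pattern_weight_le16; apply: qchar_norm_le1.
  rewrite inE QE mulf_eq0 negb_or => /andP[xE].
  rewrite !mulf_eq0 !negb_or => /andP[/andP[/andP[/andP[x2 x29] x0] x3] x27].
  have q1 : f1 x != 0 by apply: twice_sub_neq0 n2 x2.
  have q2 : f2 x != 0 by apply: twice_sub_neq0 n2 x29.
  have q3 : f3 x != 0 := mulf_neq0 x0 x3.
  have q4 : f4 x != 0 := mulf_neq0 x0 x27.
  have [[e1 e2 e3 e4]|w0] := sign_pattern (qchar_cases q1) (qchar_cases q2)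
    (qchar_cases q3) (qchar_cases q4).
    by have := none x; rewrite xE e1 e2 e3 e4 !eqxx.
  by rewrite /w w0.
(* [432 = 27 * 16]: at most 27 roots of [Q], each of weight at most 16. *)
have w_sum : \sum_x w x <= 432.
  apply: le_trans (ler_sum _ (fun x _ => w_le x)) _.
  rewrite -big_mkcond sumr_const; exact: (ler_wpMn2l (isT : 0 <= 16 :> int) B_small).
have := pattern_bound p_large (erefl _) s1 s2 s3 s4 s12 s34 s13 s14 s23 s24 s134 s234 s123 s124 s1234.
by rewrite -[X in _ < X]sum_w ltNge w_sum.
Qed.

(** * Small primes *)

Section Certificate.
Local Open Scope Z_scope.

Fixpoint powmod (m b : Z) (e : positive) : Z :=
  match e with
  | xH => b mod m
  | xO e' => let y := powmod m b e' in (y * y) mod m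
  | xI e' => let y := powmod m b e' in (b * ((y * y) mod m)) mod m
  end.

Definition euler_nonsquare (m x : Z) : bool :=
  match Z.div2 m with
  | Zpos h => powmod m x h =? m - 1
  | _ => false
  end.

Definition good_parameterb (m t : Z) : bool :=
  ~~ (excluded t mod m =? 0) && all (euler_nonsquare m) (discriminants t).

(** The list holds the primes up to the square root of 3100, so below 3100 exactly the composite
    numbers are detected and [certify] consumes one parameter per remaining prime. *)
Definition has_small_divisor (n : Z) : bool :=
  has (fun d => (d <? n) && (n mod d =? 0))
    [:: 2; 3; 5; 7; 11; 13; 17; 19; 23; 29; 31; 37; 41; 43; 47; 53].

Definition exceptional_prime (n : Z) : bool := has (Z.eqb n) [:: 11; 13; 31; 67].

Fixpoint certify (k : nat) (n : Z) (ts : seq Z) : bool :=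
  if k is k'.+1 then
    if has_small_divisor n || exceptional_prime n then certify k' (Z.succ n) ts
    else if ts is t :: ts' then good_parameterb n t && certify k' (Z.succ n) ts' else false
  else true.

(* One [t] for each prime below 3100 that is at least 11 and not exceptional. *)
Definition small_parameters : seq Z := [::
5; 5; 11; 8; 11; 24; 36; 8; 17; 10; 5; 7; 7; 7; 20; 16; 7; 21; 10; 17; 75; 41; 15; 56; 44;
14; 26; 7; 11; 10; 5; 23; 8; 11; 7; 17; 49; 11; 5; 10; 15; 16; 14; 31; 24; 10; 7; 13; 38;
13; 23; 25; 24; 33; 15; 11; 33; 11; 14; 13; 47; 5; 7; 7; 11; 33; 20; 10; 46; 45; 48; 13;
13; 29; 20; 47; 40; 22; 36; 22; 21; 17; 22; 26; 66; 23; 14; 8; 16; 26; 14; 29; 39; 17; 20;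
41; 5; 16; 16; 8; 7; 37; 43; 32; 54; 29; 7; 32; 16; 8; 11; 8; 31; 17; 39; 10; 50; 43; 11;
11; 10; 29; 5; 21; 10; 11; 13; 25; 83; 15; 11; 39; 5; 38; 34; 31; 77; 11; 33; 5; 10; 11;
23; 32; 22; 49; 10; 10; 36; 16; 7; 26; 10; 13; 33; 10; 21; 11; 10; 33; 54; 21; 8; 11; 7;
22; 11; 26; 5; 36; 38; 5; 11; 26; 11; 7; 29; 11; 23; 15; 36; 13; 33; 15; 31; 11; 17; 7;
25; 32; 5; 8; 8; 37; 16; 31; 10; 56; 16; 25; 44; 10; 22; 11; 11; 15; 13; 16; 44; 17; 31;
11; 5; 42; 21; 53; 20; 62; 31; 10; 20; 20; 23; 34; 7; 41; 20; 5; 37; 45; 20; 11; 10; 5;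
10; 14; 40; 17; 11; 16; 34; 5; 29; 54; 11; 40; 21; 23; 11; 15; 55; 22; 13; 26; 51; 33; 8;
10; 8; 14; 57; 33; 11; 14; 7; 7; 23; 10; 13; 5; 25; 21; 5; 10; 5; 5; 24; 11; 33; 44; 34;
39; 11; 21; 5; 34; 36; 56; 48; 23; 24; 20; 7; 26; 20; 10; 39; 41; 31; 13; 7; 42; 8; 63;
14; 32; 5; 24; 10; 7; 7; 63; 14; 33; 79; 17; 22; 40; 20; 15; 5; 39; 5; 36; 45; 21; 20; 21;
11; 7; 16; 15; 13; 26; 49; 7; 11; 8; 11; 13; 17; 11; 17; 41; 55; 33; 61; 7; 11; 24; 5; 21;
32; 24; 15; 8; 22; 33; 60; 36; 25; 43; 34; 5; 8; 34; 32; 44; 7; 22; 17; 23; 36; 33; 34;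
22; 48; 14; 11; 11; 15; 10; 49; 11; 43; 20; 11; 13; 46; 17; 20; 63; 40; 23; 17; 14; 47;
37; 48; 32; 15; 16; 7; 17; 34; 20; 13; 21; 20; 11; 8; 38; 8; 36; 11; 25; 7; 23; 10; 32;
10; 23; 16; 42; 20; 14; 11; 17; 36; 14; 10; 34; 16; 48
].

(** [3089 = 3100 - 11]: the range ends where [pattern_exists] takes over. *)
Lemma certify_small : certify 3089 11 small_parameters.
Proof. by vm_compute. Qed.

Lemma certifyP k n ts m : certify k n ts -> n <= m < n + Z.of_nat k ->
  [|| has_small_divisor m | exceptional_prime m] \/ exists t, good_parameterb m t.
Proof.
elim: k n ts => [|k IHk] n ts /=; first by lia.
have [->|nm] := Z.eq_dec m n.
  by case: ifP => [_ _ _|_]; [left | case: ts => // t ts /andP[good _] _; right; exists t].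
have next ts' : certify k (Z.succ n) ts' -> n <= m < n + Z.of_nat k.+1 ->
    [|| has_small_divisor m | exceptional_prime m] \/ exists t, good_parameterb m t.
  move=> cert m_range; apply: IHk cert _; clear -nm m_range; lia.
case: ifP => [_|_]; first exact: next.
by case: ts => // t ts /andP[_]; apply: next.
Qed.

End Certificate.

(** * From integer certificates to the field with [p] elements *)

Section Reduction.
Variable p : nat.
Hypothesis p_prime : prime p.

Definition redZ : {rmorphism Z -> 'F_p} := intr \o int_of_Z.

Lemma redZ_modulus : redZ (Z.of_nat p) = 0.
Proof. by rewrite /redZ /= -(pchar_Fp_0 p_prime) pmulrn; congr (_ %:~R); lia. Qed.

Let redZD a b : redZ (Z.add a b) = redZ a + redZ b. Proof. exact: rmorphD. Qed.
Let redZM a b : redZ (Z.mul a b) = redZ a * redZ b. Proof. exact: rmorphM. Qed.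

Lemma redZ_mod x : redZ (Z.modulo x (Z.of_nat p)) = redZ x.
Proof.
have pn0 : Z.of_nat p <> Z0 by have := prime_gt0 p_prime; lia.
by rewrite [in RHS](Z.div_mod x _ pn0) redZD redZM redZ_modulus mul0r add0r.
Qed.

Lemma redZ_powmod x e : redZ (powmod (Z.of_nat p) x e) = redZ x ^+ Pos.to_nat e.
Proof.
elim: e => [e IHe|e IHe|]; rewrite [powmod _ _ _]/= redZ_mod ?redZM ?redZ_mod ?redZM ?IHe -?exprD.
- by rewrite -exprS; congr (_ ^+ _); lia.
- by congr (_ ^+ _); lia.
- by rewrite Pos2Nat.inj_1.
Qed.

Lemma redZ_eq0 x : redZ x = 0 -> Z.modulo x (Z.of_nat p) = Z0.
Proof.
move=> /eqP; rewrite /redZ /= -(dvdz_pcharf (pchar_Fp p_prime)) => /dvdzP[q xq].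
apply/Z.mod_divide; first by have := prime_gt0 p_prime; lia.
exists (Z_of_int q); rewrite -[x]int_of_ZK xq.
by rewrite rmorphM.
Qed.

Hypothesis p_odd : odd p.

Lemma euler_nonsquareP x : euler_nonsquare (Z.of_nat p) x -> forall d, d ^+ 2 != redZ x.
Proof.
have h_gt0 := half_prime_gt0 p_prime p_odd.
have p2 := odd_double_half p; rewrite p_odd add1n in p2.
rewrite /euler_nonsquare; case div2: (Z.div2 _) => [|h|//] //.
have hE : Pos.to_nat h = p./2.
  have := Z.div2_odd (Z.of_nat p); rewrite div2; case: Z.odd;
    move: p2; rewrite -muln2; clear; move: p./2 => q; lia.
move=> /Z.eqb_spec powE d; apply: qcharN1_nonsquare => //.
have powN1 : redZ x ^+ p./2 = -1.
  rewrite -hE -redZ_powmod powE (redZD _ (Z.opp 1)) redZ_modulus add0r.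
  exact: (rmorphN1 redZ).
rewrite /qchar powN1 oppr1_neq1 //; case: eqP => // x0.
by move: powN1; rewrite x0 expr0n gtn_eqF // => /esym/eqP; rewrite oppr_eq0 oner_eq0.
Qed.

Lemma good_parameterP t : good_parameterb (Z.of_nat p) t -> good_parameter (redZ t).
Proof.
case/andP=> ex nonsq; split.
  by rewrite -rmorph_excluded; apply: contraNneq ex => /redZ_eq0 ->.
have -> : discriminants (redZ t) = map redZ (discriminants t).
  by rewrite /= !(rmorphM, rmorphB, rmorph_nat).
by move=> _ /mapP[x /(allP nonsq) x_nonsq ->] d; apply: euler_nonsquareP.
Qed.

Lemma has_small_divisorN : has_small_divisor (Z.of_nat p) = false.
Proof.
apply/negP => /hasP[d d_in /andP[/Z.ltb_spec0 dp /Z.eqb_spec dvd]].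
have d1 : Z.lt 1 d by move: d_in; rewrite !inE; do ![case/orP]; move/eqP=> ->.
have /(primeP p_prime).2 : (Z.to_nat d %| p)%N.
  apply/dvdnP; exists (Z.to_nat (Z.div (Z.of_nat p) d)).
  by have := Z.div_mod (Z.of_nat p) d; nia.
by case/orP => /eqP; lia.
Qed.

Lemma small_prime_parameter : (11 <= p < 3100)%N -> p \notin [:: 11; 13; 31; 67] ->
  exists t : 'F_p, good_parameter t.
Proof.
move=> p_range p_nexc.
have [] := certifyP certify_small (m := Z.of_nat p); first by lia.
  rewrite has_small_divisorN /= => exc; case/negP: p_nexc.
  case/hasP: exc => z z_in /Z.eqb_spec pz; move: z_in; rewrite -pz !inE.
  by case/or4P => /eqP pE; apply/or4P;
    [apply: Or41 | apply: Or42 | apply: Or43 | apply: Or44]; apply/eqP; clear -pE; lia.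
by case=> t /good_parameterP; exists (redZ t).
Qed.
End Reduction.

(** * Permutations given by tables *)

(* Vectors over [F_p] are encoded as the lists of their coordinates; a table is a
   map on such lists, stored as [k] levels of nested lists. *)
Fixpoint words (p k : nat) : seq (seq nat) :=
  if k is k'.+1 then [seq x :: w | x <- iota 0 p, w <- words p k'] else [:: [::]].

(** The third term [2 y - x] of the progression starting with [x, y]; adding [p - x] avoids
    truncated subtraction. *)
Definition reflect_digit (p x y : nat) : nat := ((2 * y + (p - x)) %% p)%N.

Fixpoint reflect_word (p : nat) (u v : seq nat) : seq nat :=
  match u, v with
  | x :: u', y :: v' => reflect_digit p x y :: reflect_word p u' v'
  | _, _ => [::]
  end.

Fixpoint table (k : nat) : Type := if k is k'.+1 then seq (table k') else seq nat.

Definition empty_table (k : nat) : table k :=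
  match k with 0 => [::] | _.+1 => [::] end.

Fixpoint lookup (k : nat) : table k -> seq nat -> seq nat :=
  match k with
  | 0 => fun t _ => t
  | k'.+1 => fun t w => if w is x :: w' then lookup (nth (empty_table k') t x) w' else [::]
  end.

(** The third term of a progression is determined by the first two, so the test runs over pairs
    only; words and images are computed once in [graph]. *)
Definition table_destroys (p k : nat) (T : table k) : bool :=
  let graph := [seq (w, lookup T w) | w <- words p k] in
  [&& all (fun u => (size u.2 == k) && all (fun x => (x < p)%N) u.2) graph,
      uniq (unzip2 graph) &
      all (fun u => all (fun v => (u.1 == v.1) ||
        (lookup T (reflect_word p u.1 v.1) != reflect_word p u.2 v.2)) graph) graph].

Definition table_11_1 : table 1 :=
  [::[::5]; [::0]; [::3]; [::1]; [::2]; [::9]; [::7]; [::10]; [::8]; [::4]; [::6]].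

Definition table_13_1 : table 1 :=
  [::[::1]; [::10]; [::11]; [::5]; [::6]; [::2]; [::3]; [::7]; [::8]; [::0]; [::9]; [::12];
  [::4]].

Definition table_31_1 : table 1 :=
  [::[::16]; [::10]; [::19]; [::17]; [::5]; [::28]; [::7]; [::15]; [::13]; [::14]; [::24];
  [::26]; [::2]; [::22]; [::21]; [::25]; [::0]; [::23]; [::20]; [::18]; [::4]; [::9]; [::29];
  [::30]; [::3]; [::8]; [::27]; [::6]; [::11]; [::12]; [::1]].

Definition table_67_1 : table 1 :=
  [::[::48]; [::36]; [::64]; [::7]; [::42]; [::24]; [::45]; [::49]; [::41]; [::59]; [::57];
  [::51]; [::35]; [::37]; [::38]; [::10]; [::63]; [::23]; [::12]; [::2]; [::0]; [::33]; [::1];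
  [::47]; [::19]; [::14]; [::46]; [::18]; [::43]; [::60]; [::29]; [::20]; [::27]; [::56];
  [::28]; [::62]; [::54]; [::21]; [::4]; [::5]; [::55]; [::65]; [::3]; [::34]; [::16]; [::8];
  [::6]; [::61]; [::17]; [::39]; [::13]; [::52]; [::11]; [::22]; [::30]; [::32]; [::40];
  [::50]; [::58]; [::25]; [::31]; [::44]; [::66]; [::26]; [::15]; [::53]; [::9]].

Definition table_3_2 : table 2 :=
  [::[::[::1;2]; [::2;0]; [::0;0]]; [::[::2;1]; [::1;1]; [::2;2]]; [::[::1;0]; [::0;1];
  [::0;2]]].

Definition table_5_2 : table 2 :=
  [::[::[::4;2]; [::0;1]; [::4;0]; [::1;2]; [::1;3]]; [::[::0;0]; [::2;1]; [::3;0]; [::4;1];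
  [::3;3]]; [::[::0;3]; [::4;3]; [::1;4]; [::3;2]; [::3;1]]; [::[::2;2]; [::2;4]; [::2;0];
  [::4;4]; [::0;2]]; [::[::1;1]; [::0;4]; [::2;3]; [::3;4]; [::1;0]]].

Definition table_7_2 : table 2 :=
  [::[::[::1;3]; [::6;3]; [::4;0]; [::0;6]; [::6;1]; [::1;1]; [::4;3]]; [::[::1;5]; [::3;4];
  [::6;2]; [::1;6]; [::3;2]; [::0;3]; [::5;6]]; [::[::1;4]; [::0;1]; [::4;4]; [::2;2];
  [::3;5]; [::3;1]; [::4;1]]; [::[::0;2]; [::3;3]; [::2;3]; [::2;1]; [::3;6]; [::5;5];
  [::1;2]]; [::[::3;0]; [::5;2]; [::2;5]; [::5;1]; [::6;0]; [::4;6]; [::2;0]]; [::[::5;0];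
  [::1;0]; [::0;4]; [::6;5]; [::0;5]; [::0;0]; [::5;3]]; [::[::2;4]; [::6;6]; [::4;2];
  [::4;5]; [::2;6]; [::6;4]; [::5;4]]].

Definition table_3_3 : table 3 :=
  [::[::[::[::2;2;0]; [::0;0;2]; [::0;0;1]]; [::[::2;2;1]; [::1;1;0]; [::1;2;1]];
  [::[::1;2;0]; [::0;2;0]; [::1;1;1]]]; [::[::[::2;1;1]; [::2;1;2]; [::0;1;2]]; [::[::2;1;0];
  [::1;2;2]; [::0;1;0]]; [::[::1;0;1]; [::2;0;1]; [::0;2;2]]]; [::[::[::2;2;2]; [::2;0;2];
  [::0;2;1]]; [::[::0;0;0]; [::1;1;2]; [::1;0;0]]; [::[::1;0;2]; [::2;0;0]; [::0;1;1]]]].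

Definition table_5_3 : table 3 :=
  [::[::[::[::3;4;2]; [::1;2;4]; [::2;1;2]; [::2;0;2]; [::2;1;1]]; [::[::4;2;0]; [::4;1;2];
  [::3;1;3]; [::4;1;1]; [::1;2;1]]; [::[::0;3;3]; [::3;2;4]; [::2;3;3]; [::4;4;2]; [::3;2;0]];
  [::[::1;0;2]; [::2;4;1]; [::3;1;0]; [::0;3;2]; [::4;1;3]]; [::[::4;0;0]; [::3;4;4];
  [::0;0;0]; [::4;2;1]; [::3;0;2]]]; [::[::[::4;4;4]; [::4;2;4]; [::1;1;0]; [::0;1;1];
  [::1;0;0]]; [::[::2;0;1]; [::0;3;4]; [::4;3;4]; [::1;0;1]; [::3;2;2]]; [::[::0;1;2];
  [::0;2;3]; [::0;4;1]; [::0;4;4]; [::1;2;2]]; [::[::1;4;2]; [::2;2;4]; [::1;3;1]; [::0;1;3];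
  [::4;1;4]]; [::[::2;4;0]; [::0;0;3]; [::2;1;4]; [::2;1;0]; [::3;3;1]]]; [::[::[::0;4;2];
  [::3;3;4]; [::2;3;2]; [::3;4;0]; [::2;2;0]]; [::[::4;0;1]; [::2;4;4]; [::4;3;2]; [::1;1;3];
  [::0;0;4]]; [::[::3;1;4]; [::2;2;3]; [::0;3;0]; [::4;3;3]; [::3;2;1]]; [::[::2;0;4];
  [::0;0;2]; [::1;1;1]; [::4;1;0]; [::3;3;0]]; [::[::2;0;0]; [::0;0;1]; [::1;1;4]; [::2;0;3];
  [::2;4;3]]]; [::[::[::1;3;3]; [::0;1;4]; [::1;2;3]; [::1;1;2]; [::1;4;3]]; [::[::0;2;4];
  [::1;3;4]; [::1;4;1]; [::2;3;1]; [::3;0;3]]; [::[::1;3;0]; [::3;4;1]; [::2;3;4]; [::4;3;1];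
  [::1;2;0]]; [::[::0;4;3]; [::3;1;2]; [::3;4;3]; [::3;3;3]; [::3;1;1]]; [::[::1;0;3];
  [::3;0;4]; [::4;0;3]; [::0;2;0]; [::4;4;1]]]; [::[::[::3;0;1]; [::2;1;3]; [::2;3;0];
  [::0;1;0]; [::1;4;4]]; [::[::4;2;3]; [::4;0;2]; [::1;0;4]; [::4;4;3]; [::0;3;1]];
  [::[::1;3;2]; [::2;2;1]; [::4;4;0]; [::0;2;2]; [::4;2;2]]; [::[::2;4;2]; [::1;4;0];
  [::0;4;0]; [::3;2;3]; [::2;2;2]]; [::[::4;0;4]; [::0;2;1]; [::4;3;0]; [::3;3;2];
  [::3;0;0]]]].

Definition table_7_3 : table 3 :=
  [::[::[::[::1;6;6]; [::6;1;0]; [::4;3;6]; [::2;1;4]; [::4;2;0]; [::2;4;1]; [::4;4;0]];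
  [::[::1;6;2]; [::6;6;6]; [::5;1;4]; [::0;3;1]; [::5;4;6]; [::1;5;2]; [::5;6;0]];
  [::[::6;1;3]; [::1;4;2]; [::2;5;1]; [::1;4;6]; [::1;4;5]; [::3;2;1]; [::6;3;2]];
  [::[::5;3;3]; [::4;6;4]; [::0;3;3]; [::1;5;1]; [::5;0;5]; [::4;0;5]; [::6;5;5]];
  [::[::5;0;4]; [::3;3;0]; [::4;5;3]; [::4;1;3]; [::6;0;2]; [::3;4;4]; [::0;4;5]];
  [::[::4;1;1]; [::5;6;6]; [::3;6;2]; [::2;1;2]; [::2;1;6]; [::1;2;1]; [::1;3;1]];
  [::[::2;2;1]; [::0;2;4]; [::4;2;3]; [::0;6;6]; [::3;2;2]; [::1;6;1]; [::4;1;4]]];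
  [::[::[::1;2;2]; [::5;0;3]; [::5;0;6]; [::2;2;4]; [::2;2;0]; [::1;5;5]; [::5;2;3]];
  [::[::3;5;4]; [::1;4;4]; [::1;0;6]; [::2;6;0]; [::4;0;2]; [::5;4;0]; [::0;1;0]];
  [::[::5;5;2]; [::5;4;1]; [::1;5;0]; [::4;4;2]; [::0;4;4]; [::3;6;0]; [::1;5;3]];
  [::[::0;5;1]; [::5;4;2]; [::2;0;2]; [::6;4;2]; [::6;2;1]; [::3;6;1]; [::3;6;4]];
  [::[::6;2;3]; [::2;3;2]; [::5;2;2]; [::6;1;4]; [::1;0;2]; [::0;6;3]; [::6;3;5]];
  [::[::2;1;3]; [::3;3;4]; [::2;5;6]; [::2;6;3]; [::0;6;1]; [::6;0;1]; [::5;1;0]];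
  [::[::0;2;6]; [::0;4;0]; [::0;1;3]; [::4;2;6]; [::4;6;3]; [::5;4;5]; [::3;0;5]]];
  [::[::[::2;0;0]; [::0;0;2]; [::1;5;4]; [::5;6;2]; [::3;3;6]; [::2;4;0]; [::5;3;2]];
  [::[::3;4;1]; [::3;5;3]; [::5;2;5]; [::3;0;3]; [::0;3;0]; [::6;3;6]; [::4;0;6]];
  [::[::6;0;5]; [::6;6;3]; [::1;4;1]; [::5;5;1]; [::5;4;3]; [::0;5;0]; [::5;3;1]];
  [::[::1;6;4]; [::1;0;5]; [::1;3;4]; [::0;0;1]; [::5;5;3]; [::1;0;3]; [::3;6;6]];
  [::[::5;1;2]; [::5;5;5]; [::4;2;5]; [::4;0;1]; [::0;0;5]; [::1;1;5]; [::4;6;2]];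
  [::[::5;1;5]; [::5;5;4]; [::2;4;5]; [::5;3;5]; [::3;2;4]; [::4;4;4]; [::6;1;2]];
  [::[::4;5;4]; [::6;2;2]; [::6;1;1]; [::2;3;3]; [::2;3;5]; [::2;3;1]; [::2;2;5]]];
  [::[::[::6;0;3]; [::5;3;0]; [::6;4;4]; [::4;3;3]; [::3;5;2]; [::6;0;4]; [::6;5;6]];
  [::[::4;2;2]; [::3;2;0]; [::1;2;6]; [::3;1;0]; [::3;1;5]; [::2;5;4]; [::3;4;0]];
  [::[::3;1;4]; [::1;6;0]; [::4;5;2]; [::0;4;1]; [::4;2;1]; [::5;6;4]; [::0;6;2]];
  [::[::6;6;1]; [::4;3;4]; [::1;0;0]; [::5;3;6]; [::4;0;0]; [::4;3;2]; [::2;3;4]];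
  [::[::3;4;3]; [::0;5;4]; [::4;5;0]; [::5;6;5]; [::2;0;6]; [::3;4;5]; [::1;3;6]];
  [::[::5;2;1]; [::2;6;5]; [::6;1;6]; [::2;0;5]; [::4;4;3]; [::1;2;5]; [::0;5;5]];
  [::[::2;6;4]; [::4;6;6]; [::3;5;1]; [::4;1;2]; [::1;2;3]; [::6;5;2]; [::0;2;5]]];
  [::[::[::4;5;1]; [::6;2;4]; [::2;4;3]; [::5;5;6]; [::4;3;5]; [::5;2;0]; [::0;3;2]];
  [::[::2;0;4]; [::6;4;5]; [::4;4;1]; [::6;5;3]; [::4;3;0]; [::6;5;1]; [::5;1;3]];
  [::[::1;6;3]; [::1;3;3]; [::5;1;1]; [::0;0;3]; [::6;2;5]; [::5;0;0]; [::0;0;0]];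
  [::[::6;3;0]; [::4;6;1]; [::4;3;1]; [::3;1;2]; [::5;3;4]; [::4;1;6]; [::1;0;1]];
  [::[::5;0;1]; [::6;0;6]; [::2;5;3]; [::5;6;3]; [::1;4;0]; [::3;0;6]; [::6;6;0]];
  [::[::3;5;0]; [::0;2;2]; [::3;0;0]; [::1;3;5]; [::6;0;0]; [::2;2;3]; [::3;2;3]];
  [::[::5;1;6]; [::1;1;6]; [::4;1;5]; [::3;4;6]; [::1;2;4]; [::3;2;6]; [::6;2;0]]];
  [::[::[::2;6;2]; [::0;1;5]; [::1;3;0]; [::3;2;5]; [::6;6;2]; [::1;1;4]; [::3;4;2]];
  [::[::2;1;0]; [::1;2;0]; [::0;4;3]; [::0;5;3]; [::1;1;0]; [::0;3;4]; [::0;3;5]];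
  [::[::5;6;1]; [::6;4;6]; [::6;6;5]; [::0;0;4]; [::0;1;1]; [::2;6;6]; [::1;3;2]];
  [::[::3;3;1]; [::6;4;3]; [::0;6;0]; [::0;5;6]; [::4;4;6]; [::2;2;2]; [::0;4;6]];
  [::[::2;6;1]; [::3;1;6]; [::2;4;6]; [::0;1;6]; [::3;3;3]; [::0;2;1]; [::2;5;0]];
  [::[::6;3;4]; [::3;6;3]; [::4;4;5]; [::2;3;0]; [::2;3;6]; [::6;5;0]; [::6;6;4]];
  [::[::4;2;4]; [::4;5;5]; [::5;5;0]; [::6;4;0]; [::6;5;4]; [::3;6;5]; [::5;2;4]]];
  [::[::[::3;0;1]; [::3;0;2]; [::5;2;6]; [::6;2;6]; [::4;1;0]; [::0;6;4]; [::1;5;6]];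
  [::[::5;4;4]; [::3;0;4]; [::0;1;2]; [::1;4;3]; [::2;5;2]; [::6;3;1]; [::2;4;4]];
  [::[::3;3;2]; [::1;6;5]; [::0;2;3]; [::0;1;4]; [::2;2;6]; [::4;0;4]; [::2;0;1]];
  [::[::0;0;6]; [::3;3;5]; [::3;1;3]; [::4;5;6]; [::0;5;2]; [::0;3;6]; [::1;1;2]];
  [::[::5;0;2]; [::3;5;5]; [::4;0;3]; [::2;1;5]; [::6;4;1]; [::2;0;3]; [::2;4;2]];
  [::[::6;1;5]; [::1;1;1]; [::4;6;5]; [::6;3;3]; [::0;4;2]; [::4;6;0]; [::1;1;3]];
  [::[::0;6;5]; [::3;1;1]; [::0;2;0]; [::2;5;5]; [::2;1;1]; [::3;5;6]; [::1;0;4]]]].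

Lemma tables_destroy :
  [&& table_destroys 11 table_11_1, table_destroys 13 table_13_1,
      table_destroys 31 table_31_1, table_destroys 67 table_67_1,
      table_destroys 3 table_3_2, table_destroys 5 table_5_2, table_destroys 7 table_7_2,
      table_destroys 3 table_3_3 & table_destroys 5 table_5_3].
Proof. by vm_compute. Qed.

Lemma table_7_3_destroys : table_destroys 7 table_7_3.
Proof. by vm_compute. Qed.

Definition destroys_none (p : nat) : bool :=
  all (fun s => has (fun xy => (xy.1 != xy.2) &&
         (nth 0%N s (reflect_digit p xy.1 xy.2)
            == reflect_digit p (nth 0%N s xy.1) (nth 0%N s xy.2)))
       [seq (x, y) | x <- iota 0 p, y <- iota 0 p]) (permutations (iota 0 p)).

(** An exhaustive search, of at most [7! = 5040] permutations for each prime. *)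
Lemma destroys_none357 : [&& destroys_none 3, destroys_none 5 & destroys_none 7].
Proof. by vm_compute. Qed.

(** * Products, and the passage between tables and permutations *)

Definition destructible (p k : nat) : Prop :=
  exists pi : 'rV['F_p]_k -> 'rV['F_p]_k, ap_destroying pi.

Lemma ap_destroyingE (G : zmodType) (pi : G -> G) (a b c : G) :
  ap_destroying pi -> a + c = b + b -> c != b -> pi a + pi c != pi b + pi b.
Proof.
case=> _ pi_ap abc cb; apply/negP => /eqP piabc; apply: pi_ap; exists a, b, c.
split; first by apply/eqP; rewrite eq_sym subr_eq -[b - a + b]addrAC -abc addrAC subrr add0r.
  by apply/eqP; rewrite subr_eq0.
by apply/eqP; rewrite eq_sym subr_eq -[pi b - pi a + _]addrAC -piabc addrAC subrr add0r.
Qed.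

(** A nonconstant progression is nonconstant in one of the two blocks of coordinates, and there its
    image already fails to be a progression. *)
Lemma destructible_add (p k l : nat) :
  destructible p k -> destructible p l -> destructible p (k + l).
Proof.
move=> [f fP] [g gP]; have [[f' fK f'K] _] := fP; have [[g' gK g'K] _] := gP.
exists (fun v => row_mx (f (lsubmx v)) (g (rsubmx v))); apply: ap_destroyingI.
  exists (fun v => row_mx (f' (lsubmx v)) (g' (rsubmx v))) => v;
    by rewrite row_mxKl row_mxKr ?fK ?gK ?f'K ?g'K hsubmxK.
move=> a b c abc; apply: contraNneq; rewrite !add_row_mx => /eq_row_mx[fabc gabc].
have lE : lsubmx a + lsubmx c = lsubmx b + lsubmx b by rewrite -!linearD abc.
have rE : rsubmx a + rsubmx c = rsubmx b + rsubmx b by rewrite -!linearD abc.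
have [lcb|/(ap_destroyingE fP lE)] := eqVneq (lsubmx c) (lsubmx b); last by rewrite fabc eqxx.
have [rcb|/(ap_destroyingE gP rE)] := eqVneq (rsubmx c) (rsubmx b); last by rewrite gabc eqxx.
by rewrite -[c]hsubmxK lcb rcb hsubmxK.
Qed.

Lemma destructible_field (p : nat) (pi : 'F_p -> 'F_p) :
  ap_destroying pi -> destructible p 1.
Proof.
move=> piP; have [[pi' piK pi'K] _] := piP.
have colE (v : 'rV['F_p]_1) : const_mx (v 0 0) = v.
  by apply/rowP => i; rewrite mxE ord1.
exists (fun v : 'rV_1 => const_mx (pi (v 0 0)) : 'rV_1); apply: ap_destroyingI.
  by exists (fun v : 'rV_1 => const_mx (pi' (v 0 0)) : 'rV_1) => v; rewrite mxE ?piK ?pi'K colE.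
move=> a b c abc cb; apply/eqP => /(congr1 (fun v : 'rV_1 => v 0 0)); rewrite !mxE.
apply/eqP/(ap_destroyingE piP); first by have := congr1 (fun v : 'rV_1 => v 0 0) abc; rewrite !mxE.
by apply: contraNneq cb => cb0; rewrite -[c]colE cb0 colE.
Qed.

Lemma uniq_map_inj (T1 T2 : eqType) (f : T1 -> T2) (s : seq T1) :
  uniq (map f s) -> {in s &, injective f}.
Proof.
elim: s => //= z s IHs /andP[fz us] x y; rewrite !inE.
case/predU1P => [->|xs] /predU1P[->|ys] // fxy; last exact: IHs.
  by case/negP: fz; rewrite fxy map_f.
by case/negP: fz; rewrite -fxy map_f.
Qed.

Section Words.
Variable p : nat.
Hypothesis p_prime : prime p.

Definition word (k : nat) (v : 'rV['F_p]_k) : seq nat := [seq val (v 0 i) | i <- enum 'I_k].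
Definition unword (k : nat) (w : seq nat) : 'rV['F_p]_k := \row_i (nth 0%N w i)%:R.

Lemma val_Fp_lt (x : 'F_p) : (x < p)%N.
Proof. by rewrite -[X in (_ < X)%N](Fp_cast p_prime) ltn_ord. Qed.

Lemma val_natr_Fp (n : nat) : val (n%:R : 'F_p) = (n %% p)%N.
Proof. exact: val_Fp_nat. Qed.

Lemma size_word k (v : 'rV['F_p]_k) : size (word v) = k.
Proof. by rewrite size_map size_enum_ord. Qed.

Lemma nth_word k (v : 'rV['F_p]_k) (i : 'I_k) : nth 0%N (word v) i = val (v 0 i).
Proof. by rewrite (nth_map i) ?size_enum_ord // nth_ord_enum. Qed.

Lemma wordK k : cancel (@word k) (unword k).
Proof. by move=> v; apply/rowP => i; rewrite mxE nth_word natr_Zp. Qed.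

Lemma unwordK k w : size w = k -> all (fun x => (x < p)%N) w -> word (unword k w) = w.
Proof.
move=> wk w_p; apply: (@eq_from_nth _ 0%N); rewrite size_word // => i ik.
rewrite (nth_word _ (Ordinal ik)) mxE val_natr_Fp modn_small //.
by apply: (allP w_p); rewrite mem_nth ?wk.
Qed.

Lemma word_mem k (v : 'rV['F_p]_k) : word v \in words p k.
Proof.
have words_mem w : all (fun x => (x < p)%N) w -> w \in words p (size w).
  elim: w => //= x w IHw /andP[xp w_p].
  by apply/allpairsP; exists (x, w); rewrite mem_iota add0n xp IHw.
rewrite -[in words p k](size_word v) words_mem //.
by apply/allP => _ /mapP[i _ ->]; apply: val_Fp_lt.
Qed.

Lemma val_reflect (x y : 'F_p) : val (y + y - x) = reflect_digit p (val x) (val y).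
Proof.
rewrite /reflect_digit -val_natr_Fp natrD natrM natrB; last exact: ltnW (val_Fp_lt x).
by rewrite pchar_Fp_0 // sub0r !natr_Zp mulr_natl mulr2n.
Qed.

Lemma nth_reflect_word (u v : seq nat) i : (i < size u)%N -> (i < size v)%N ->
  nth 0%N (reflect_word p u v) i = reflect_digit p (nth 0%N u i) (nth 0%N v i).
Proof. by elim: u v i => [|x u IHu] [|y v] [|i] //= ? ?; apply: IHu. Qed.

Lemma size_reflect_word (u v : seq nat) : size u = size v -> size (reflect_word p u v) = size u.
Proof. by elim: u v => [|x u IHu] [|y v] //= [/IHu ->]. Qed.

Lemma word_reflect k (a b : 'rV['F_p]_k) : word (b + b - a) = reflect_word p (word a) (word b).
Proof.
apply: (@eq_from_nth _ 0%N); first by rewrite size_reflect_word !size_word.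
rewrite size_word => i ik; rewrite nth_reflect_word ?size_word //.
by rewrite !(nth_word _ (Ordinal ik)) !mxE val_reflect.
Qed.

Lemma table_destructible k (T : table k) : table_destroys p T -> destructible p k.
Proof.
case/and3P; set graph := [seq _ | w <- _].
move=> /allP rangeT uniqT /allP destT.
pose f (v : 'rV['F_p]_k) := unword k (lookup T (word v)).
have mem_graph (v : 'rV['F_p]_k) : (word v, lookup T (word v)) \in graph.
  by apply: map_f; apply: word_mem.
have wordf v : word (f v) = lookup T (word v).
  by have /= /andP[/eqP sz w_p] := rangeT _ (mem_graph v); apply: unwordK.
exists f; apply: ap_destroyingI.
  apply: injF_bij => u v /(congr1 (@word k)); rewrite !wordf => eqT.
  apply: (can_inj (@wordK k)); move: uniqT.
  by rewrite /unzip2 -map_comp => /uniq_map_inj; apply; rewrite ?word_mem.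
move=> a b c abc cb; apply/eqP => fabc.
have cE : c = b + b - a by rewrite -abc addrAC subrr add0r.
have fcE : f c = f b + f b - f a by rewrite -fabc addrAC subrr add0r.
have /allP/(_ _ (mem_graph b)) := destT _ (mem_graph a).
rewrite /= -!wordf -!word_reflect -cE -fcE -wordf eqxx orbF => /eqP/(can_inj (@wordK k)) ab.
by rewrite cE ab addrK eqxx in cb.
Qed.

(** A permutation of the line is encoded as the list [s] of its values at [0, ..., p - 1];
    injectivity places [s] among the enumerated permutations, and the preserved triple found there
    is carried back to vectors. *)
Lemma destroys_noneP : destroys_none p -> ~ destructible p 1.
Proof.
move=> /allP none [pi piP]; have [/bij_inj pi_inj _] := piP.
pose f x := val (pi (const_mx x%:R) 0 0).
have const_inj x y : (x < p)%N -> (y < p)%N ->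
    const_mx x%:R = const_mx y%:R :> 'rV['F_p]_1 -> x = y.
  move=> xp yp /(congr1 (fun v : 'rV_1 => val (v 0 0))).
  by rewrite !mxE !val_natr_Fp !modn_small.
have f_lt x : (f x < p)%N by apply: val_Fp_lt.
have piE x : pi (const_mx x%:R) = const_mx (f x)%:R.
  by apply/rowP => i; rewrite mxE ord1 natr_Zp.
pose s := mkseq f p.
have s_uniq : uniq s.
  apply/mkseq_uniqP => x y; rewrite !inE => xp yp fxy.
  by apply: const_inj => //; apply: pi_inj; rewrite !piE fxy.
have : s \in permutations (iota 0 p).
  rewrite mem_permutations uniq_perm ?iota_uniq //.
  have s_sub : {subset s <= iota 0 p}.
    by move=> _ /mapP[x _ ->]; rewrite mem_iota add0n f_lt.
  by have [|_ eqs] := uniq_min_size s_uniq s_sub; rewrite ?size_mkseq ?size_iota.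
case/none/hasP => -[x y] /allpairsP[[x' y'] /= [x_in y_in [-> ->]]] /andP[xy].
move: x_in y_in xy; rewrite !mem_iota !add0n /= => xp yp xy.
have zp : (reflect_digit p x' y' < p)%N by rewrite ltn_mod prime_gt0.
rewrite !nth_mkseq // => /eqP fxy.
pose v z : 'rV['F_p]_1 := const_mx z%:R.
have reflE a b : (a < p)%N -> v (reflect_digit p a b) = v b + v b - v a.
  move=> ap; apply/rowP => i; rewrite !mxE Fp_nat_mod // natrD natrM natrB ?(ltnW ap) //.
  by rewrite pchar_Fp_0 // sub0r mulr_natl mulr2n.
have cE := reflE x' y' xp; have fcE := reflE _ (f y') (f_lt x').
have cb : v (reflect_digit p x' y') != v y'.
  apply: contraNneq xy; rewrite cE => /eqP; rewrite -addrA -subr_eq0 addrAC subrr add0r subr_eq0.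
  by move/eqP/const_inj => ->.
have := ap_destroyingE piP _ cb; move/(_ (v x')); rewrite cE addrC subrK => /(_ erefl).
by rewrite -cE {2}/v piE fxy -/(v _) fcE /v !piE addrC subrK eqxx.
Qed.
End Words.

(** * The classification of pairs [(p, k)] *)

Lemma not_destructible2 k : (0 < k)%N -> ~ destructible 2 k.
Proof.
case: k => // k _ [pi piP]; pose e : 'rV['F_2]_k.+1 := const_mx 1.
have dbl (v : 'rV['F_2]_k.+1) : v + v = 0.
  by apply/rowP => i; rewrite !mxE -mulr2n -mulr_natr (_ : 2%:R = 0) ?mulr0 //; apply/val_inj.
have e_neq0 : 0 != e by apply/eqP => /rowP/(_ 0); rewrite !mxE.
by have := ap_destroyingE (a := 0) piP (etrans (addr0 0) (esym (dbl e))) e_neq0; rewrite !dbl eqxx.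
Qed.

Lemma destructible_prime_ge11 p : prime p -> odd p -> (11 <= p)%N -> destructible p 1.
Proof.
move=> p_prime p_odd p11.
have [|nexc] := boolP (p \in [:: 11; 13; 31; 67]%N).
  rewrite !inE => /or4P exc.
  have /and5P[t11 t13 t31 t67 _] := tables_destroy.
  move: p_prime; case: exc => /eqP -> prime_p.
  - exact (table_destructible prime_p t11).
  - exact (table_destructible prime_p t13).
  - exact (table_destructible prime_p t31).
  - exact (table_destructible prime_p t67).
have natF n : (0 < n < 11)%N -> n%:R != 0 :> 'F_p.
  by case/andP=> n0 n11; rewrite natF_neq0 // n0 (leq_trans n11).
have two0 : 2 != 0 :> 'F_p := natF 2%N isT.
have three0 : 3 != 0 :> 'F_p := natF 3%N isT.
have five0 : 5 != 0 :> 'F_p := natF 5%N isT.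
suff [t good_t] : exists t : 'F_p, good_parameter t.
  apply: (@destructible_field p (cycle_inv t)).
  exact: cycle_inv_ap_destroying two0 three0 five0 good_t.
have [p_small|p_large] := ltnP p 3100.
  by apply: small_prime_parameter; rewrite ?p11.
have [t [ex q1 q2 q3 q4]] := pattern_exists p_prime p_odd p_large.
have qM := qcharM p_prime p_odd.
have t0 : t != 0 by apply: contraPneq q3 => ->; rewrite mul0r qchar0.
exists t; split=> // x; rewrite !inE => /or4P[] /eqP -> d; apply: qcharN1_nonsquare => //.
(* Multiplied by the square of [2], the second discriminant becomes a product of two factors with
   opposite characters; the fourth is treated in the same way with the square of [t]. *)
- rewrite -(qchar_sqrM p_prime p_odd _ two0).
  have -> : 2 ^+ 2 * ((2 - t) * (2 - 9 * t)) = (2 * (2 - t)) * (2 * (2 - 9 * t)) by rewrite expr2 mulrACA.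
  by rewrite qM q1 q2.
- rewrite -(qchar_sqrM p_prime p_odd _ t0).
  have -> : t ^+ 2 * ((t - 3) * (t - 27)) = (t * (t - 3)) * (t * (t - 27)).
    by rewrite expr2 mulrACA.
  by rewrite qM q3 q4.
Qed.

(** Used for the primes 3, 5 and 7, where dimension one fails: every [k >= 2] is a sum of twos and
    threes. *)
Lemma destructible_ge2 p k : destructible p 2 -> destructible p 3 -> (2 <= k)%N -> destructible p k.
Proof.
move=> d2 d3; elim/ltn_ind: k => -[|[|[|[|k]]]] // IHk _.
by rewrite -[k.+4]/(2 + k.+2)%N; apply: destructible_add => //; apply: IHk.
Qed.

Lemma destructible_ge1 p k : destructible p 1 -> (1 <= k)%N -> destructible p k.
Proof.
move=> d1; elim: k => [|[|k] IHk] // _.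
by rewrite -[k.+2]/(1 + k.+1)%N; apply: destructible_add => //; apply: IHk.
Qed.

Theorem theorem1p2 (p k : nat) (p_prime : prime p) (k_gt0 : (0 < k)%N) :
  (exists pi : 'rV['F_p]_k -> 'rV['F_p]_k, ap_destroying pi) <->
  odd p /\ (p, k) \notin [:: (3, 1); (5, 1); (7, 1)]%N.
Proof.
rewrite -/(destructible p k); split=> [dpk|[p_odd pk]].
  have p_odd : odd p.
    have [p2|//] := even_prime p_prime.
    by move: dpk; rewrite p2 => /(not_destructible2 k_gt0).
  split=> //; apply/negP; have /and3P[n3 n5 n7] := destroys_none357.
  rewrite !inE => /or3P[] /eqP[pE kE]; move: dpk p_prime; rewrite pE kE => dpk prime_p.
  - exact: destroys_noneP prime_p n3 dpk.
  - exact: destroys_noneP prime_p n5 dpk.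
  - exact: destroys_noneP prime_p n7 dpk.
have [p11|p_small] := leqP 11 p.
  by apply: destructible_ge1 k_gt0; apply: destructible_prime_ge11.
have /and5P[_ _ _ _ /and5P[t32 t52 t72 t33 t53]] := tables_destroy.
have : p \in [seq q <- iota 0 11 | prime q && odd q].
  by rewrite mem_filter p_prime p_odd mem_iota.
rewrite [filter _ _]/= !inE => /or3P[] /eqP pE.
- move: pk p_prime; rewrite pE => pk prime_p; apply: destructible_ge2.
  + exact (table_destructible prime_p t32).
  + exact (table_destructible prime_p t33).
  + by case: k k_gt0 pk => [|[|k]].
- move: pk p_prime; rewrite pE => pk prime_p; apply: destructible_ge2.
  + exact (table_destructible prime_p t52).
  + exact (table_destructible prime_p t53).
  + by case: k k_gt0 pk => [|[|k]].
- move: pk p_prime; rewrite pE => pk prime_p; apply: destructible_ge2.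
  + exact (table_destructible prime_p t72).
  + exact (table_destructible prime_p table_7_3_destroys).
  + by case: k k_gt0 pk => [|[|k]].
Qed.
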